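(* Let $p\ge 2$ and let $\boldsymbol J_N$, $N\ge1$, be the interaction tensors of the $p$-spin Sherrington–Kirkpatrick model, that is, $J_{i_1\ldots i_p}=N^{\frac{1-p}{2}}g_{i_1\ldots i_p}$, where $(g_{i_1\ldots i_p})_{1\leq i_1<\cdots<i_p<\infty}$ is a realization of a collection of independent standard Gaussian random variables, extended symmetrically to all tuples of distinct indices, and $J_{i_1\ldots i_p}=0$ if two indices coincide. Then, for almost every realization of $(g_{i_1\ldots i_p})$, the maximum pseudo-likelihood (MPL) estimate $\hat{\beta}_N(\boldsymbol X)$, based on a single sample $\boldsymbol X\sim\mathbb{P}_\beta$ from the $p$-tensor Ising model with interaction tensor $\boldsymbol J_N$, is $\sqrt{N}$-consistent for all $\beta> 0$.
   Context: Let $\mathcal{C}_N=\{-1,1\}^N$. The $p$-tensor Ising model with interaction tensor $\boldsymbol J_N=((J_{i_1\ldots i_p}))_{1\le i_1,\ldots,i_p\le N}$ and parameter $\beta\ge0$ is the probability distribution on $\mathcal{C}_N$ given by $\mathbb{P}_{\beta}(\boldsymbol x)=\frac{1}{2^N Z_N(\beta)}e^{\beta H_N(\boldsymbol x)}$, where $H_N(\boldsymbol x)=\sum_{1\leq i_1,\ldots,i_p\leq N}J_{i_1\ldots i_p}x_{i_1}\cdots x_{i_p}$ and $Z_N(\beta)=\frac{1}{2^N}\sum_{\boldsymbol x\in\mathcal{C}_N}e^{\beta H_N(\boldsymbol x)}$. With $m_i(\boldsymbol x)=\sum_{1\leq i_2,\ldots,i_p\leq N}J_{i i_2\ldots i_p}x_{i_2}\cdots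 x_{i_p}$, the MPL estimate is $$\hat\beta_N(\boldsymbol X)=\inf\Big\{b\geq 0: H_N(\boldsymbol X)=\sum_{i=1}^N m_i(\boldsymbol X)\tanh\big(p\,b\,m_i(\boldsymbol X)\big)\Big\},$$ with $\inf\emptyset=+\infty$. $\sqrt N$-consistency at $\beta$ means: for every $\delta>0$ there is $M=M(\delta,\beta)>0$ such that $\mathbb{P}_\beta(\sqrt N|\hat\beta_N(\boldsymbol X)-\beta|\le M)>1-\delta$ for all $N$ large enough. *)

(* Defs.v *)
From mathcomp Require Import all_boot all_order all_algebra.
From mathcomp Require Import all_classical all_reals all_analysis.

Set Implicit Arguments.
Unset Strict Implicit.
Unset Printing Implicit Defensive.

Import Order.TTheory GRing.Theory Num.Theory.
Import numFieldNormedType.Exports.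

Local Open Scope classical_set_scope.
Local Open Scope ring_scope.

Definition tanh {R : realType} (x : R) : R :=
  (expR x - expR (- x)) / (expR x + expR (- x)).

(* {-1, 1}^N is encoded as {ffun 'I_N -> bool}, [true] standing for 1. *)
Definition spin {R : realType} {N : nat} (x : {ffun 'I_N -> bool}) (i : 'I_N) :
  R := if x i then 1 else -1.

Section Ising.
Context {R : realType} {p N : nat}.
Implicit Types (J : p.-tuple 'I_N -> R) (x : {ffun 'I_N -> bool}) (beta : R).

Definition hamiltonian J x : R :=
  \sum_(t : p.-tuple 'I_N) J t * \prod_(j <- t) spin x j.

(* The sum over (i_2, ..., i_p) is the sum over the p-tuples t with head i. *)
Definition local_field J (i : 'I_N) x : R :=
  \sum_(t : p.-tuple 'I_N | ohead t == Some i)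
    J t * \prod_(j <- behead t) spin x j.

Definition partition_fun J beta : R :=
  (2 ^+ N)^-1 *
  \sum_(x : {ffun 'I_N -> bool}) expR (beta * hamiltonian J x).

Definition ising_pmf J beta x : R :=
  (2 ^+ N * partition_fun J beta)^-1 * expR (beta * hamiltonian J x).

Definition ising_prob J beta (A : pred {ffun 'I_N -> bool}) : R :=
  \sum_(x | A x) ising_pmf J beta x.

(* [ereal_inf set0 = +oo]. *)
Definition mpl J x : \bar R :=
  ereal_inf [set b%:E | b in [set b : R | 0 <= b /\
    hamiltonian J x =
    \sum_(i < N) local_field J i x * tanh (p%:R * b * local_field J i x)]].

End Ising.

Definition mpl_sqrt_consistent {R : realType} {p : nat}
    (J : forall N, p.-tuple 'I_N -> R) (beta : R) : Prop :=
  forall delta : R, 0 < delta -> exists2 M : R, 0 < M &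
    \forall N \near \oo,
      1 - delta < ising_prob (J N) beta (fun x =>
        ((Num.sqrt N%:R)%:E * `|mpl (J N) x - beta%:E| <= M%:E)%E).

Definition incr_tuple (p : nat) := {t : p.-tuple nat | sorted ltn t}.

(* Sorting the indices gives an increasing tuple iff they are distinct;
   otherwise [insub] returns [None] and the coupling is 0. *)
Definition sk_tensor {R : realType} {p : nat} (g : incr_tuple p -> R) (N : nat)
    (t : p.-tuple 'I_N) : R :=
  if insub (sort_tuple leq (map_tuple val t)) is Some s
  then N%:R `^ ((1 - p%:R) / 2) * g s else 0.

Definition mutually_independent {R : realType} {d : measure_display}
    {T : measurableType d} (P : probability T R) {I : eqType}
    (X : I -> {RV P >-> R}) : Prop :=
  forall (s : seq I) (B : I -> set R), uniq s ->
    (forall i, i \in s -> measurable (B i)) ->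
    P (\bigcap_(i in [set` s]) (X i @^-1` B i)) =
    (\prod_(i <- s) P (X i @^-1` B i))%E.

Definition standard_gaussian {R : realType} {d : measure_display}
    {T : measurableType d} (P : probability T R) (X : {RV P >-> R}) : Prop :=
  forall B : set R, measurable B -> distribution P X B = normal_prob 0 1 B.

(* Main.v *)
Require Import Defs.
From mathcomp Require Import all_boot all_order all_algebra.
From mathcomp Require Import fingroup perm.
From mathcomp Require Import all_classical all_reals all_analysis.
From mathcomp Require Import measurable_realfun.
From mathcomp Require Import ring lra zify.

(** Write [m_i] for the local fields and
    [phi(b) = sum_i m_i (x_i - tanh (p b m_i))], so that the estimate is a root
    of [phi].  The couplings vanish on repeated indices and are symmetric, hence
    [tanh (p beta m_i)] is the conditional mean of [x_i] given the other spins.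
    The proof has a deterministic half, valid for each tensor that satisfies
    three bounds, and a probabilistic half, which shows that almost every
    Gaussian realization satisfies them for all large [N].

    Deterministic half.  [phi(beta)] is a sum of terms that are centered given
    the other spins, so its second moment is governed by the increments of
    [phi] under single spin flips.  A second order expansion bounds them by
    a multiple of [N] as soon as the matrices obtained by contracting [p - 2]
    slots of [J] with spins have rows of bounded length and map sign vectors to
    vectors of length O(sqrt N); this is [score_second_moment].  If moreover
    the partition function grows exponentially, then configurations with energy
    below [eps N] have exponentially small probability.  An energy of order [N]
    together with [sum_i m_i^2 = O(N)] forces a positive fraction of the mass of
    the fields to have bounded size, so [- phi'] is of order [N] near [beta]
    ([bulk_local_field], [tanh_slope]).  A function of size O(sqrt N) at [beta]
    with such a slope has its root within O(1 / sqrt N) of [beta]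
    ([mpl_close], [mpl_consistency]).

    The partition function.  It is bounded below by Gibbs' variational principle
    with the following trial law: spins outside a block [B] of proportion 1/p
    are uniform, and given them the spins in [B] are independent with mean [s]
    times the sign of their cavity field, the field created by the spins
    outside [B].  The energy gain is linear in [s] and proportional to the
    average of [sum_B |h_b|], while the interaction inside [B] and the entropy
    cost O(s^2 N); a small [s] wins ([variational_lb], [mform_second_order],
    [free_energy_lb]).  The average of [sum_B h_b^2] is computed by
    orthogonality of the characters of the cube ([sum_cavity_sqr_lb]), and the
    mean of [|h_b|] is recovered from it once large fields are known to
    contribute little ([sum_abs_cavity_lb]).

    Probabilistic half.  Every quantity to be controlled is a vector [w] of
    linear forms in the couplings such that [<k, w>] is Gaussian with
    variance at most [p! |k|^2] ([mform_mgf]).  If many coordinates of [w] are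
    large, rounding them towards zero gives an integer vector [k] with
    [<k, w> >= |k|^2]; summing the exponential moments over all [k] gives
    a factorized sum ([lattice_fun], [sum_lattice_gaussian]).  Requiring
    [|w_i| >= 1] and a large total square beats the number of choices of the
    other slots, which is exponential in [N] ([contraction_sup_bound]);
    requiring [|w_i| >= K] with [K] large makes the tail contribution small for
    all but a small fraction of the spin configurations
    ([contraction_tail_fraction]).  Finally the sum of [g_t^2] over about
    [(N / p)^p] index sets is bounded below ([sum_sqr_gaussian_lb]).  Each bound
    holds eventually because the corresponding expectations are summable in
    [N] ([ae_cvg0_of_summable]); the exceptional set does not involve [beta]. *)

Set Implicit Arguments.
Unset Strict Implicit.
Unset Printing Implicit Defensive.

Import Order.TTheory GRing.Theory Num.Theory.
Import numFieldNormedType.Exports.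

Local Open Scope classical_set_scope.
Local Open Scope ring_scope.

(** * The hyperbolic tangent *)

Section tanh_calculus.
Context {R : realType}.
Implicit Types a b c m u x y : R.

Lemma mvt_between (f f' : R -> R) a b : (forall x, is_derive x 1 f (f' x)) ->
  exists2 c, Num.min a b <= c <= Num.max a b & f b - f a = f' c * (b - a).
Proof.
move=> df.
have cf x y : {within `[x, y], continuous f}.
  by apply: derivable_within_continuous => z _; apply: ex_derive.
have [ab|ab] := leP a b.
  have [c] := MVT_segment ab (fun x _ => df x) (cf _ _).
  by rewrite in_itv /= => cab E; exists c.
have [c] := MVT_segment (ltW ab) (fun x _ => df x) (cf _ _).
by rewrite in_itv /= => cab E; exists c => //; rewrite -opprB E; ring.
Qed.

Lemma denom_tanh_gt0 x : 0 < expR x + expR (- x).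
Proof. by rewrite addr_gt0 ?expR_gt0. Qed.

Lemma is_derive_tanh x : is_derive x 1 (@tanh R) (1 - tanh x ^+ 2).
Proof.
have dN : is_derive x 1 (fun y : R => expR (- y)) (- expR (- x)).
  apply: (@is_derive_eq _ _ _ _ _ _ _ _
    (@is_derive1_comp R expR -%R x _ _ (is_derive_expR _) _)).
  by rewrite mulrN1.
have D0 : expR x + expR (- x) != 0 by rewrite gt_eqF ?denom_tanh_gt0.
have dD : is_derive x 1 (fun y : R => expR y + expR (- y)) (expR x - expR (- x)).
  exact: is_deriveD.
have dS : is_derive x 1 (fun y : R => expR y - expR (- y)) (expR x + expR (- x)).
  by apply: (is_derive_eq (is_deriveB _ dN)); rewrite opprK.
have dV := @is_deriveV R (fun y : R => expR y + expR (- y)) x _ 1 D0 dD.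
apply: (is_derive_eq (is_deriveM dS dV)).
rewrite /tanh -![_ *: _]/(_ * _).
by field.
Qed.

Lemma tanhE2 x : 1 - tanh x ^+ 2 = 4 / (expR x + expR (- x)) ^+ 2.
Proof.
have D0 : expR x + expR (- x) != 0 by rewrite gt_eqF ?denom_tanh_gt0.
have E : expR x * expR (- x) = 1 by rewrite expRxMexpNx_1.
rewrite /tanh; apply: (@mulIf _ ((expR x + expR (- x)) ^+ 2)).
  by rewrite expf_neq0.
rewrite divfK ?expf_neq0// mulrBl mul1r expr_div_n divfK ?expf_neq0//.
by ring: E.
Qed.

Lemma sech2_ge0 x : 0 <= 1 - tanh x ^+ 2.
Proof. by rewrite tanhE2 divr_ge0 ?sqr_ge0. Qed.

Lemma sech2_le1 x : 1 - tanh x ^+ 2 <= 1.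
Proof. by rewrite gerBl sqr_ge0. Qed.

Lemma tanh_le1 x : `|tanh x| <= 1.
Proof.
have := sech2_ge0 x; rewrite subr_ge0 -[X in _ <= X -> _](expr1n _ 2).
by rewrite -[X in X <= _ -> _]real_normK ?num_real// ler_sqr ?nnegrE.
Qed.

(** The denominator of [1 - tanh^2 = 4 / (e^x + e^-x)^2] is at most
    [4 e^(2 l)] on [[-l, l]]. *)
Lemma sech2_lb x l : `|x| <= l -> expR (- (2 * l)) <= 1 - tanh x ^+ 2.
Proof.
move=> xl; rewrite tanhE2 ler_pdivlMr ?exprn_gt0 ?denom_tanh_gt0//.
have h : expR x + expR (- x) <= 2 * expR l.
  rewrite mulr_natl mulr2n lerD// ler_expR; first exact: le_trans (ler_norm _) xl.
  by apply: le_trans xl; rewrite -normrN ler_norm.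
have := @lerXn2r _ 2 _ _ (ltW (denom_tanh_gt0 x)) (_ : 0 <= 2 * expR l) h.
rewrite mulr_ge0 ?expR_ge0// => /(_ isT) h2.
apply: (le_trans (ler_wpM2l (expR_ge0 _) h2)).
have -> : expR (- (2 * l)) = expR l ^- 2 by rewrite expRN -expRM_natl.
rewrite exprMn mulrCA mulVf ?mulr1 ?expf_neq0 ?gt_eqF ?expR_gt0//.
by rewrite expr2; lra.
Qed.

(** [e^x + e^-x] is at least [1 + |x|] and at least 2, so its square dominates
    [2 |x|]. *)
Lemma mul_sech2_le2 x : `|x| * (1 - tanh x ^+ 2) <= 2.
Proof.
rewrite tanhE2 mulrA ler_pdivrMr ?exprn_gt0 ?denom_tanh_gt0//.
set D := expR x + expR (- x).
have h1 : 1 + `|x| <= D.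
  rewrite /D; have [x0|x0] := leP 0 x.
    by rewrite ger0_norm// (le_trans (expR_ge1Dx x))// lerDl expR_ge0.
  by rewrite ltr0_norm// (le_trans (expR_ge1Dx (- x)))// lerDr expR_ge0.
have h2 : 2 <= D.
  have := expR_ge1Dx x; have := expR_ge1Dx (- x); rewrite /D; lra.
have := normr_ge0 x => x0; rewrite expr2; nra.
Qed.

Lemma is_derive_tanhM c x :
  is_derive x 1 (fun y => tanh (c * y)) (c * (1 - tanh (c * x) ^+ 2)).
Proof.
have dc : is_derive x 1 (fun y : R => c * y) c.
  by apply: (is_derive_eq (is_deriveZ c (is_derive_id x 1))); rewrite [_ *: _]mulr1.
apply: (@is_derive_eq _ _ _ _ _ _ _ _
    (@is_derive1_comp R (@tanh R) (fun y => c * y) x _ _ (is_derive_tanh _) dc)).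
by rewrite mulrC.
Qed.

Lemma is_derive_mul_tanh c x :
  is_derive x 1 (fun y => y * tanh (c * y))
    (tanh (c * x) + c * x * (1 - tanh (c * x) ^+ 2)).
Proof.
have dM := is_deriveM (is_derive_id x (1 : R)) (is_derive_tanhM c x).
by apply: (is_derive_eq dM); rewrite -![_ *: _]/(_ * _); ring.
Qed.

Lemma is_derive_dmul_tanh c x :
  is_derive x 1 (fun y => tanh (c * y) + c * y * (1 - tanh (c * y) ^+ 2))
    (2 * c * (1 - tanh (c * x) ^+ 2) -
     2 * c * (c * x * (1 - tanh (c * x) ^+ 2)) * tanh (c * x)).
Proof.
have dt := is_derive_tanhM c x.
have dc : is_derive x 1 (fun y : R => c * y) c.
  by apply: (is_derive_eq (is_deriveZ c (is_derive_id x 1))); rewrite [_ *: _]mulr1.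
have dt2 := is_deriveM dt dt.
have d1 := is_deriveB (is_derive_cst (1 : R) x 1) dt2.
have d2 := is_deriveD dt (is_deriveM dc d1).
apply: (is_derive_eq d2); rewrite -![_ *: _]/(_ * _).
by rewrite -[(cst 1 - _) x]/(1 - tanh (c * x) * tanh (c * x)); ring.
Qed.

Lemma dmul_tanh_le3 c x :
  `|tanh (c * x) + c * x * (1 - tanh (c * x) ^+ 2)| <= 3.
Proof.
apply: le_trans (ler_normD _ _) _.
rewrite [X in _ + X]normrM (ger0_norm (sech2_ge0 _)).
have := tanh_le1 (c * x); have := mul_sech2_le2 (c * x); lra.
Qed.

(** The second derivative of [y tanh (c y)] is bounded because [|v| sech^2 v] is.
    This controls the change of a summand of the score when its local field
    moves. *)
Lemma mul_tanh_taylor c x y : 0 <= c ->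
  `|y * tanh (c * y) - x * tanh (c * x)
    - (tanh (c * x) + c * x * (1 - tanh (c * x) ^+ 2)) * (y - x)|
  <= 6 * c * (y - x) ^+ 2.
Proof.
move=> c0.
have [z zxy ->] := mvt_between x y (is_derive_mul_tanh c).
rewrite -mulrBl.
have [w _ ->] := mvt_between x z (is_derive_dmul_tanh c).
have zx : `|z - x| <= `|y - x|.
  move: zxy => /andP[]; have [xy|xy] := leP x y => h1 h2.
    by rewrite !ger0_norm ?subr_ge0// lerD2r.
  by rewrite !ler0_norm ?subr_le0 ?(ltW xy)//; lra.
have d2 : `|2 * c * (1 - tanh (c * w) ^+ 2) -
     2 * c * (c * w * (1 - tanh (c * w) ^+ 2)) * tanh (c * w)| <= 6 * c.
  have := tanh_le1 (c * w); have := mul_sech2_le2 (c * w).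
  have := sech2_le1 (c * w); have := sech2_ge0 (c * w).
  move: (1 - tanh (c * w) ^+ 2) => S; move: (tanh _) => T S0 S1 vS t1.
  apply: le_trans (ler_normB _ _) _.
  rewrite !normrM (ger0_norm S0) (ger0_norm c0) (ger0_norm (ler0n _ 2)).
  have := normr_ge0 T; move: vS t1; rewrite normrM (ger0_norm c0).
  set t := `|T|; set v := c * `|w| => vS t1 t0.
  have : v * S * t <= 2.
    apply: (le_trans _ vS); rewrite ler_piMr// mulr_ge0// /v mulr_ge0//.
  move=> h; have : c * (v * S * t) <= c * 2 by exact: ler_wpM2l.
  have : c * S <= c * 1 by exact: ler_wpM2l.
  lra.
rewrite !normrM -mulrA -[(y - x) ^+ 2]real_normK ?num_real// expr2.
by apply: ler_pM => //; exact: ler_wpM2r.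
Qed.

(** Quantitative strict monotonicity in [b] of the summands of the MPL equation;
    only fields of bounded size give a rate that does not depend on [N]. *)
Lemma tanh_slope m l b b' : b <= b' -> `|b * m| <= l -> `|b' * m| <= l ->
  expR (- (2 * l)) * m ^+ 2 * (b' - b) <= m * (tanh (b' * m) - tanh (b * m)).
Proof.
move=> bb' hb hb'.
have [z /andP[z1 z2] ->] := mvt_between (b * m) (b' * m) is_derive_tanh.
have zl : `|z| <= l.
  rewrite ler_norml; move: hb hb'; rewrite !ler_norml => /andP[? ?] /andP[? ?].
  apply/andP; split; first by apply: le_trans z1; rewrite le_min; apply/andP.
  by apply: (le_trans z2); rewrite ge_max; apply/andP.
have -> : m * ((1 - tanh z ^+ 2) * (b' * m - b * m)) =
          (1 - tanh z ^+ 2) * (m ^+ 2 * (b' - b)) by ring.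
rewrite -mulrA; apply: ler_wpM2r; last exact: sech2_lb.
by rewrite mulr_ge0 ?sqr_ge0// subr_ge0.
Qed.

Lemma tanh_mono m b b' : b <= b' ->
  0 <= m * (tanh (b' * m) - tanh (b * m)).
Proof.
move=> bb'; apply: le_trans (@tanh_slope m (Num.max `|b * m| `|b' * m|) b b' bb' _ _).
- by rewrite mulr_ge0 ?subr_ge0// mulr_ge0 ?sqr_ge0 ?expR_ge0.
- by rewrite le_max lexx.
- by rewrite le_max lexx orbT.
Qed.

Lemma continuous_tanh : continuous (@tanh R).
Proof.
move=> x; apply: differentiable_continuous; apply/derivable1_diffP.
exact: (@ex_derive _ _ _ _ _ _ _ (is_derive_tanh x)).
Qed.

End tanh_calculus.

(** * Multilinear forms of symmetric tensors *)

Section multilinear_form.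
Context {R : realType} {p N : nat}.
Variable J : p.-tuple 'I_N -> R.
Implicit Types (z : 'I_p -> 'I_N -> R) (u v : 'I_N -> R).

(** The [p]-linear form of the tensor, slot [j] being fed with the vector [z j].
    The Hamiltonian, the local fields and their discrete derivatives are values
    of this form at spin and basis vectors. *)
Definition mform z : R :=
  \sum_(t : p.-tuple 'I_N) J t * \prod_(j < p) z j (tnth t j).

Definition set_slot (j0 : 'I_p) u z : 'I_p -> 'I_N -> R :=
  fun j => if j == j0 then u else z j.

Definition basis (i : 'I_N) : 'I_N -> R := fun k => (k == i)%:R.

Lemma eq_mform z1 z2 : (forall j i, z1 j i = z2 j i) -> mform z1 = mform z2.
Proof.
by move=> E; apply: eq_bigr => t _; congr (_ * _); apply: eq_bigr => j _.
Qed.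

Lemma prod_set_slot j u z (t : p.-tuple 'I_N) :
  \prod_(k < p) set_slot j u z k (tnth t k) =
  u (tnth t j) * \prod_(k < p | k != j) z k (tnth t k).
Proof.
rewrite (bigD1 j)//= {1}/set_slot eqxx; congr (_ * _).
by apply: eq_bigr => k /negbTE kj; rewrite /set_slot kj.
Qed.

Lemma mform_slot_sum j u z :
  mform (set_slot j u z) = \sum_i u i * mform (set_slot j (basis i) z).
Proof.
under eq_bigr do rewrite mulr_sumr.
rewrite exchange_big /=; apply: eq_bigr => t _.
under eq_bigr do rewrite prod_set_slot.
rewrite prod_set_slot (bigD1 (tnth t j))//= [X in _ + X]big1 ?addr0.
  by rewrite {1}/basis eqxx mul1r mulrCA.
by move=> i /negbTE ij; rewrite /basis eq_sym ij mul0r !mulr0.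
Qed.

Lemma mform_slotZ j (c : R) u z :
  mform (set_slot j (fun i => c * u i) z) = c * mform (set_slot j u z).
Proof.
rewrite /mform mulr_sumr; apply: eq_bigr => t _.
by rewrite !prod_set_slot; ring.
Qed.

End multilinear_form.

Section symmetric_tensor.
Context {R : realType} {p N : nat}.
Variable J : p.-tuple 'I_N -> R.
Hypothesis symJ : forall t t' : p.-tuple 'I_N, perm_eq t t' -> J t = J t'.
Hypothesis diagJ : forall t : p.-tuple 'I_N, ~~ uniq t -> J t = 0.
Implicit Types (z : 'I_p -> 'I_N -> R) (u v : 'I_N -> R).
Implicit Types (x : {ffun 'I_N -> bool}).

Lemma mform_perm (s : {perm 'I_p}) z : mform J (fun j => z (s j)) = mform J z.
Proof.
pose h (t : p.-tuple 'I_N) := [tuple tnth t (s^-1%g j) | j < p].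
have hK : cancel h (fun t => [tuple tnth t (s j) | j < p]).
  by move=> t; apply: eq_from_tnth => j; rewrite !tnth_mktuple permK.
have hK' : cancel (fun t : p.-tuple 'I_N => [tuple tnth t (s j) | j < p]) h.
  by move=> t; apply: eq_from_tnth => j; rewrite !tnth_mktuple permKV.
rewrite /mform [RHS](reindex h)/=; last by exists (fun t => [tuple tnth t (s j) | j < p]) => t _.
apply: eq_bigr => t _; congr (_ * _).
  apply: symJ; apply/tuple_permP; exists s.
  congr val; apply: eq_from_tnth => j; rewrite !tnth_mktuple permK//.
rewrite [RHS](reindex_inj (@perm_inj _ s)) /=; apply: eq_bigr => j _.
by rewrite tnth_mktuple permK.
Qed.

Lemma mform_slot_any j j' u v :
  mform J (set_slot j u (fun=> v)) = mform J (set_slot j' u (fun=> v)).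
Proof.
rewrite -(mform_perm (tperm j j')); apply: eq_mform => k i.
rewrite /set_slot; case: tpermP => [->|->|/eqP/negbTE kj /eqP/negbTE kj'].
- by rewrite eq_sym.
- by rewrite !eqxx.
- by rewrite kj kj'.
Qed.

Definition flip (i : 'I_N) x : {ffun 'I_N -> bool} :=
  [ffun k => if k == i then ~~ x k else x k].

Lemma flipK i : involutive (flip i).
Proof.
by move=> x; apply/ffunP => k; rewrite !ffunE; case: eqP => // _; rewrite negbK.
Qed.

Lemma spin_flip i x k :
  spin (flip i x) k = spin x k * (1 - 2 * basis i k) :> R.
Proof.
rewrite /spin ffunE /basis; case: eqP => _ /=; last by rewrite mulr0 subr0 mulr1.
by case: (x k) => /=; ring.
Qed.

Lemma prod_1sub2 (s : seq 'I_p) (a : 'I_p -> R) :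
  (forall j k, j != k -> a j * a k = 0) -> uniq s ->
  \prod_(j <- s) (1 - 2 * a j) = 1 - 2 * \sum_(j <- s) a j.
Proof.
move=> a0; elim: s => [|j s IH]; first by rewrite !big_nil mulr0 subr0.
rewrite cons_uniq => /andP[js us]; rewrite !big_cons IH//.
have : a j * \sum_(k <- s) a k = 0.
  rewrite mulr_sumr big_seq big1// => k ks; apply: a0.
  by apply: contraNneq js => ->.
by move=> E; ring: E.
Qed.

(** As no index repeats, each monomial is affine in [x_i]: flipping [x_i] changes
    exactly the monomials in which one of the slots of [S] reads [i], and exactly
    one slot does. *)
Lemma mform_flip (S : pred 'I_p) z i x :
  mform J (fun j => if S j then spin x else z j) -
  mform J (fun j => if S j then spin (flip i x) else z j) =
  2 * spin x i * \sum_(l | S l)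
    mform J (set_slot l (basis i) (fun j => if S j then spin x else z j)).
Proof.
set zx := fun j => if S j then spin x else z j.
rewrite mulr_sumr /mform -sumrB.
under [RHS]eq_bigr do rewrite mulr_sumr.
rewrite exchange_big; apply: eq_bigr => t _ /=.
have [ut|/diagJ ->] := boolP (uniq t); last first.
  by rewrite !mul0r subr0 big1// => l _; rewrite mul0r mulr0.
have E1 : \prod_(j < p) (if S j then spin (flip i x) else z j) (tnth t j) =
    \prod_(j < p) zx j (tnth t j) *
    \prod_(j <- [seq j <- enum 'I_p | S j]) (1 - 2 * basis i (tnth t j)).
  rewrite big_filter big_enum_cond/= (big_mkcond S)/= -big_split/=.
  apply: eq_bigr => j _; rewrite /zx; case: (S j); last by rewrite mulr1.
  by rewrite spin_flip.
rewrite E1 prod_1sub2; last 2 first.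
- move=> j k jk; rewrite /basis; case: eqP => [tj|]; last by rewrite mul0r.
  case: eqP => [tk|]; last by rewrite mulr0.
  by move/tuple_uniqP: ut jk => /(_ j k); rewrite tj tk => ->//; rewrite eqxx.
- by rewrite filter_uniq// enum_uniq.
rewrite big_filter big_enum_cond/= mulrBr mulr1 !mulrBr opprB addrC subrK.
rewrite !mulr_sumr; apply: eq_bigr => l Sl.
rewrite prod_set_slot (bigD1 l)//= {1}/zx Sl /basis.
by case: eqP => [->|]; [ring|rewrite !(mulr0,mul0r)].
Qed.

End symmetric_tensor.

Section hamiltonian_forms.
Context {R : realType} {q N : nat}.
Notation p := q.+2.
Variable J : p.-tuple 'I_N -> R.
Hypothesis symJ : forall t t' : p.-tuple 'I_N, perm_eq t t' -> J t = J t'.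
Hypothesis diagJ : forall t : p.-tuple 'I_N, ~~ uniq t -> J t = 0.
Implicit Types (u v : 'I_N -> R) (x : {ffun 'I_N -> bool}).

(** [bform (basis j) (basis i) x] is the entry [(j, i)] of the matrix obtained by
    feeding the spins into the other [p - 2] slots. *)
Definition bform u v x : R :=
  mform J (set_slot ord0 u (set_slot (lift ord0 ord0) v (fun=> spin x))).

Lemma hamiltonianE x : hamiltonian J x = mform J (fun=> spin x).
Proof. by apply: eq_bigr => t _; rewrite big_tuple. Qed.

Lemma local_fieldE i x :
  local_field J i x = mform J (set_slot ord0 (basis i) (fun=> spin x)).
Proof.
rewrite /local_field big_mkcond; apply: eq_bigr => t _.
rewrite prod_set_slot [t]tuple_eta /= /basis tnth0 /=.
have -> : (Some (thead t) == Some i) = (thead t == i) by [].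
case: eqP => _; last by rewrite mul0r mulr0.
rewrite mul1r; congr (_ * _); rewrite (big_tuple _ _ (behead_tuple t)).
rewrite [RHS]big_mkcond [RHS]big_ord_recl/= mul1r; apply: eq_bigr => k _.
by rewrite tnthS.
Qed.

Lemma mform_spin_bform u x :
  mform J (set_slot ord0 u (fun=> spin x)) = bform u (spin x) x.
Proof.
by apply: eq_mform => j i; rewrite /set_slot; case: ifP => //; case: ifP.
Qed.

Lemma hamiltonian_bform x : hamiltonian J x = bform (spin x) (spin x) x.
Proof.
rewrite hamiltonianE -mform_spin_bform.
by apply: eq_mform => j i; rewrite /set_slot; case: ifP.
Qed.

Lemma bform_suml u v x : bform u v x = \sum_i u i * bform (basis i) v x.
Proof. exact: mform_slot_sum. Qed.

Lemma bformC u v x : bform u v x = bform v u x.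
Proof.
rewrite /bform -(mform_perm symJ (tperm ord0 (lift ord0 ord0))).
apply: eq_mform => k i; rewrite /set_slot.
case: tpermP => [->|->|/eqP/negbTE -> /eqP/negbTE ->] //.
Qed.

Lemma hamiltonian_sum x :
  hamiltonian J x = \sum_i spin x i * local_field J i x.
Proof.
rewrite hamiltonian_bform bform_suml; apply: eq_bigr => i _.
by rewrite local_fieldE mform_spin_bform.
Qed.

(** The factor [p], one for each slot that may hold [i], is the one that appears
    in the MPL equation: the conditional law of [x_i] is tilted by
    [p beta m_i]. *)
Lemma hamiltonian_flip i x :
  hamiltonian J x - hamiltonian J (flip i x) =
  2 * p%:R * spin x i * local_field J i x.
Proof.
rewrite !hamiltonianE.
have /= -> := mform_flip diagJ predT (fun=> spin x) i x.
rewrite (eq_bigr (fun=> local_field J i x)); last first.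
  by move=> l _; rewrite local_fieldE; exact: mform_slot_any.
by rewrite sumr_const card_ord -mulr_natl; ring.
Qed.

Lemma local_field_flip i j x :
  local_field J j x - local_field J j (flip i x) =
  2 * (q.+1)%:R * spin x i * bform (basis j) (basis i) x.
Proof.
rewrite !local_fieldE.
have := mform_flip diagJ (fun l : 'I_p => l != ord0) (fun=> basis j) i x.
have E y : mform J (fun l => if l != ord0 then spin y else basis j) =
           mform J (set_slot ord0 (basis j) (fun=> spin y)).
  by apply: eq_mform => l k; rewrite /set_slot; case: eqP.
rewrite !E => ->; rewrite (eq_bigr (fun=> bform (basis j) (basis i) x)).
  by rewrite sumr_const cardC1 card_ord -mulr_natl /=; ring.
move=> l l0; rewrite -(mform_perm symJ (tperm l (lift ord0 ord0))).
apply: eq_mform => k k'; rewrite /set_slot.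
case: tpermP => [->|->|/eqP/negbTE kl /eqP/negbTE kl'].
- rewrite (negbTE l0) eq_sym; case: eqP => //.
- by rewrite eqxx.
- by rewrite kl kl'; case: eqP.
Qed.

End hamiltonian_forms.

(** * Second moment of the score *)

Section second_moment.
Context {R : realType} {q N : nat}.
Notation p := q.+2.
Variable J : p.-tuple 'I_N -> R.
Hypothesis symJ : forall t t' : p.-tuple 'I_N, perm_eq t t' -> J t = J t'.
Hypothesis diagJ : forall t : p.-tuple 'I_N, ~~ uniq t -> J t = 0.
Variables (beta A : R).
Hypothesis beta0 : 0 <= beta.
Implicit Types (u v : 'I_N -> R) (x y : {ffun 'I_N -> bool}).

Notation m := (local_field J).
Let c : R := p%:R * beta.

(** The deviation of [x_i] from its conditional mean, weighted by [m_i]; up to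
    the factor [p], the contribution of [i] to the derivative of the
    log-pseudo-likelihood. *)
Definition residual i x : R :=
  m i x * (spin x i - tanh (p%:R * beta * m i x)).

Definition score x : R := \sum_i residual i x.

Lemma spin_sqr x i : spin x i * spin x i = 1 :> R.
Proof. by rewrite /spin; case: (x i); ring. Qed.

Lemma spin_normr x i : `|spin x i| = 1 :> R.
Proof. by rewrite /spin; case: (x i); rewrite ?normrN normr1. Qed.

Lemma bform_diag i x : bform J (basis i) (basis i) x = 0.
Proof.
apply: big1 => t _; have [/tuple_uniqP ut|/diagJ ->] := boolP (uniq t); last first.
  by rewrite mul0r.
rewrite (bigD1 ord0)// (bigD1 (lift ord0 ord0))//= /set_slot /= /basis.
case: eqP => [t0|]; last by rewrite !(mul0r,mulr0).
case: eqP => [t1|]; last by rewrite !(mul0r,mulr0).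
by have := ut ord0 (lift ord0 ord0); rewrite t0 t1 => /(_ erefl).
Qed.

Lemma local_field_flip_self i x : m i (flip i x) = m i x.
Proof.
apply/esym/eqP; rewrite -subr_eq0 (local_field_flip symJ diagJ) bform_diag.
by rewrite mulr0.
Qed.

Lemma spin_flip_self i x : spin (flip i x) i = - spin x i :> R.
Proof. by rewrite spin_flip /basis eqxx mulr1; ring. Qed.

(** Configurations are paired by flipping [x_i].  Their Gibbs weights are in the
    ratio [e^(2 p beta x_i m_i)], for which [tanh (p beta m_i)] is exactly the
    mean of [x_i]. *)
Lemma residual_orthogonal i (G : {ffun 'I_N -> bool} -> R) :
  (forall x, G (flip i x) = G x) ->
  \sum_x expR (beta * hamiltonian J x) * residual i x * G x = 0.
Proof.
move=> GE; set S := LHS.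
have S2 : S = \sum_x expR (beta * hamiltonian J (flip i x)) *
                     residual i (flip i x) * G x.
  rewrite /S (reindex_inj (can_inj (flipK i)))/=.
  by apply: eq_bigr => x _; rewrite GE.
suff : S + S = 0 by move=> SS; lra.
rewrite {2}S2 /S -big_split big1//= => x _; rewrite -mulrDl.
suff -> : expR (beta * hamiltonian J x) * residual i x +
    expR (beta * hamiltonian J (flip i x)) * residual i (flip i x) = 0.
  by rewrite mul0r.
rewrite /residual local_field_flip_self spin_flip_self.
have Hf := hamiltonian_flip symJ diagJ i x.
set Hx := hamiltonian J x in Hf *; set Hy := hamiltonian J (flip i x) in Hf *.
set mi := m i x in Hf *.
have -> : Hx = Hy + 2 * p%:R * spin x i * mi by rewrite -Hf; ring.
set u := p%:R * beta * mi.
have -> : beta * (Hy + 2 * p%:R * spin x i * mi) = beta * Hy + 2 * (spin x i * u).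
  by rewrite /u; ring.
rewrite expRD.
suff h : expR (2 * (spin x i * u)) * (spin x i - tanh u) = spin x i + tanh u.
  transitivity (expR (beta * Hy) * mi *
    (expR (2 * (spin x i * u)) * (spin x i - tanh u) - (spin x i + tanh u))).
    by ring.
  by rewrite h subrr mulr0.
have D0 := denom_tanh_gt0 u.
have E : expR u * expR (- u) = 1 by rewrite expRxMexpNx_1.
have E2 (v : R) : expR (2 * v) = expR v * expR v by rewrite -expRD; congr expR; ring.
rewrite E2 /tanh /spin; case: (x i).
  by rewrite mul1r; field: E; rewrite gt_eqF.
by rewrite mulN1r; field: E; rewrite gt_eqF.
Qed.

Hypothesis B1 : forall x y,
  \sum_i bform J (basis i) (spin y) x ^+ 2 <= A * N%:R.
Hypothesis B2 : forall x i,
  \sum_j bform J (basis j) (basis i) x ^+ 2 <= A.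

Lemma sum_local_field_sqr x : \sum_i m i x ^+ 2 <= A * N%:R.
Proof.
apply: le_trans (B1 x x); rewrite le_eqVlt; apply/orP; left; apply/eqP.
by apply: eq_bigr => i _; rewrite local_fieldE mform_spin_bform.
Qed.

Let D i j x := m j x - m j (flip i x).
Let h j x := spin x j - (tanh (c * m j x) + c * m j x * (1 - tanh (c * m j x) ^+ 2)).

Let residual_norm i x : `|residual i x| <= 2 * `|m i x|.
Proof.
rewrite /residual normrM mulrC; apply: ler_wpM2r => //.
apply: le_trans (ler_normB _ _) _; rewrite spin_normr.
have := tanh_le1 (p%:R * beta * m i x); lra.
Qed.

(* Increment of the [j]-th residual when [x_i] is flipped: the term [j = i] from
   the factor [x_j], then a linear and a quadratic term in the change of [m_j]. *)
Let residual_diff i j x : exists2 e : R,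
  residual j x - residual j (flip i x) =
    (j == i)%:R * (2 * spin x i * m i x) + h j x * D i j x + e &
  `|e| <= 6 * c * D i j x ^+ 2.
Proof.
have c0 : 0 <= c by rewrite mulr_ge0.
exists (m j (flip i x) * tanh (c * m j (flip i x)) - m j x * tanh (c * m j x)
    - (tanh (c * m j x) + c * m j x * (1 - tanh (c * m j x) ^+ 2)) *
      (m j (flip i x) - m j x)); last first.
  have -> : D i j x ^+ 2 = (m j (flip i x) - m j x) ^+ 2 by rewrite /D -opprB sqrrN.
  exact: mul_tanh_taylor.
rewrite /residual -/c /h /D; case: eqP => [->|/eqP/negbTE ji].
  by rewrite local_field_flip_self spin_flip_self mul1r; ring.
by rewrite spin_flip /basis ji mulr0 mul0r; ring.
Qed.

(* The form is linear in [g], so the worst bounded [g] is a multiple of a sign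
   vector, whose image under the contracted matrix is bounded by [B1]. *)
Let cross_term x (b g : 'I_N -> R) : (forall j, `|g j| <= 4) ->
  bform J g b x <= 2 * (\sum_i b i ^+ 2 + A * N%:R).
Proof.
move=> gle; pose y : {ffun 'I_N -> bool} := [ffun j => 0 <= bform J (basis j) b x].
have h1 : bform J g b x <= 4 * bform J (spin y) b x.
  rewrite bform_suml [in leRHS]bform_suml mulr_sumr; apply: ler_sum => j _.
  rewrite mulrA -[4 * _]mulrC -mulrA [spin y j * _]mulrCA.
  rewrite (_ : spin y j * _ = `|bform J (basis j) b x|); last first.
    rewrite /spin /y ffunE; case: ifPn => [h0|].
      by rewrite mul1r ger0_norm.
    by rewrite -ltNge => h0; rewrite mulN1r ltr0_norm.
  apply: le_trans (ler_norm _) _; rewrite normrM; exact: ler_wpM2r.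
apply: (le_trans h1); rewrite bformC// bform_suml mulr_sumr.
have : \sum_i (b i ^+ 2 + bform J (basis i) (spin y) x ^+ 2) <=
       \sum_i b i ^+ 2 + A * N%:R.
  by rewrite big_split lerD2l.
move=> h2; apply: le_trans (_ : 2 * _ <= _); last exact: ler_wpM2l h2.
rewrite mulr_sumr; apply: ler_sum => i _.
have := sqr_ge0 (b i - bform J (basis i) (spin y) x); rewrite sqrrB; lra.
Qed.

(** The three terms come from the diagonal, the linear and the quadratic part of
    the increments of the score under flips. *)
Definition score_bound : R :=
  2 * A + 10 * (q.+1)%:R * A + 12 * c * (q.+1)%:R ^+ 2 * A * (1 + A).

Let flip_increment x :
  \sum_i residual i x * (score x - score (flip i x)) <= 2 * score_bound * N%:R.
Proof.
have c0 : 0 <= c by rewrite mulr_ge0.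
have q0 : 0 <= q.+1%:R :> R by [].
have A0 : 0 <= A \/ N%:R = 0 :> R.
  have [/eqP->|N0] := boolP (N == 0)%N; [by right|left].
  have := sum_local_field_sqr x; have : 0 <= \sum_i m i x ^+ 2.
    by apply: sumr_ge0 => i _; exact: sqr_ge0.
  move=> h1 h2; have := le_trans h1 h2.
  by rewrite pmulr_lge0// ltr0n lt0n.
have DE i j : D i j x = 2 * q.+1%:R * spin x i * bform J (basis j) (basis i) x.
  exact: local_field_flip.
have sD i : \sum_j D i j x ^+ 2 <= 4 * q.+1%:R ^+ 2 * A.
  apply: le_trans (ler_wpM2l _ (B2 x i)); last by rewrite mulr_ge0.
  rewrite mulr_sumr le_eqVlt; apply/orP; left; apply/eqP; apply: eq_bigr => j _.
  by rewrite DE !exprMn (expr2 (spin x i)) spin_sqr; ring.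
have key i : residual i x * (score x - score (flip i x)) <=
   4 * m i x ^+ 2 + residual i x * (\sum_j h j x * D i j x) +
   (1 + m i x ^+ 2) * (24 * c * q.+1%:R ^+ 2 * A).
  have [e eE eb] : exists2 e : R, score x - score (flip i x) =
       2 * spin x i * m i x + \sum_j h j x * D i j x + e &
       `|e| <= 24 * c * q.+1%:R ^+ 2 * A.
    pose e j := projT1 (cid2 (residual_diff i j x)).
    have eP j := projT2 (cid2 (residual_diff i j x)).
    exists (\sum_j e j).
      rewrite /score -sumrB; rewrite (eq_bigr (fun j => (j == i)%:R * (2 * spin x i * m i x) +
         h j x * D i j x + e j)); last by move=> j _; rewrite /e; case: (cid2 _).
      rewrite !big_split/= (bigD1 i)//= big1 ?addr0 ?eqxx ?mul1r//.
      by move=> j /negbTE ->; rewrite mul0r.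
    apply: le_trans (ler_norm_sum _ _ _) _.
    apply: le_trans (_ : \sum_j 6 * c * D i j x ^+ 2 <= _).
      by apply: ler_sum => j _; rewrite /e; case: (cid2 _).
    rewrite -mulr_sumr; apply: le_trans (ler_wpM2l _ (sD i)) _.
      by rewrite mulr_ge0.
    by rewrite le_eqVlt; apply/orP; left; apply/eqP; ring.
  rewrite eE !mulrDr; apply: lerD; first apply: lerD => //.
    apply: le_trans (ler_norm _) _; rewrite (normrM (residual i x)).
    rewrite (normrM (_ * _)) (normrM 2) spin_normr mulr1 (ger0_norm (ler0n _ 2)).
    have := residual_norm i x; have := normr_ge0 (m i x).
    rewrite -[m i x ^+ 2]real_normK ?num_real// expr2.
    move: `|residual i x| `|m i x| => r t t0 rt.
    by have := ler_wpM2r t0 rt; lra.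
  apply: le_trans (ler_norm _) _; rewrite normrM.
  have rb : `|residual i x| <= 1 + m i x ^+ 2.
    apply: le_trans (residual_norm i x) _.
    rewrite -[m i x ^+ 2]real_normK ?num_real//.
    have := sqr_ge0 (`|m i x| - 1); rewrite !expr2; lra.
  exact: ler_pM.
apply: le_trans (ler_sum _ (fun i _ => key i)) _.
rewrite !big_split/= -mulr_sumr -mulr_suml big_split/=.
have := sum_local_field_sqr x; set S2 := \sum_i m i x ^+ 2 => S2b.
have cross : \sum_i residual i x * (\sum_j h j x * D i j x) <= 20 * q.+1%:R * A * N%:R.
  have -> : \sum_i residual i x * (\sum_j h j x * D i j x) =
     2 * q.+1%:R * bform J (h^~ x) (fun i => residual i x * spin x i) x.
    rewrite bform_suml mulr_sumr.
    under eq_bigr do rewrite mulr_sumr.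
    rewrite exchange_big; apply: eq_bigr => j _ /=.
    rewrite bformC// bform_suml !mulr_sumr; apply: eq_bigr => i _.
    by rewrite DE bformC//; ring.
  have hb j : `|h j x| <= 4.
    apply: le_trans (ler_normB _ _) _; rewrite spin_normr.
    by have := dmul_tanh_le3 c (m j x); lra.
  have := cross_term x (fun i => residual i x * spin x i) hb.
  have : \sum_i (residual i x * spin x i) ^+ 2 <= 4 * S2.
    rewrite mulr_sumr; apply: ler_sum => i _.
    rewrite exprMn (expr2 (spin x i)) spin_sqr mulr1.
    rewrite -[residual i x ^+ 2]real_normK ?num_real// -[m i x ^+ 2]real_normK ?num_real//.
    have := residual_norm i x; have := normr_ge0 (residual i x).
    have := normr_ge0 (m i x); rewrite !expr2; nra.
  move=> h1 h2.
  have h3 : bform J (h^~ x) (fun i => residual i x * spin x i) x <= 10 * (A * N%:R) by lra.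
  apply: le_trans (ler_wpM2l _ h3) _; first by rewrite mulr_ge0.
  by rewrite le_eqVlt; apply/orP; left; apply/eqP; ring.
have n1 : \sum_(i < N) 1 = N%:R :> R by rewrite sumr_const card_ord.
rewrite n1 /score_bound.
have h4 : (N%:R + S2) * (24 * c * q.+1%:R ^+ 2 * A) <=
  24 * c * q.+1%:R ^+ 2 * A * (1 + A) * N%:R.
  have -> : 24 * c * q.+1%:R ^+ 2 * A * (1 + A) * N%:R =
    (N%:R + A * N%:R) * (24 * c * q.+1%:R ^+ 2 * A) by ring.
  case: A0 => [A0|N0].
    apply: ler_wpM2r; last by rewrite lerD2l.
    by rewrite !mulr_ge0.
  have S20 : S2 = 0.
    apply/eqP; rewrite eq_le; apply/andP; split.
      by move: S2b; rewrite N0 mulr0.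
    by apply: sumr_ge0 => i _; exact: sqr_ge0.
  by rewrite S20 N0 !(mulr0, addr0).
have -> : 2 * (2 * A + 10 * q.+1%:R * A + 12 * c * q.+1%:R ^+ 2 * A * (1 + A))
    * N%:R = 4 * (A * N%:R) + 20 * q.+1%:R * A * N%:R +
      24 * c * q.+1%:R ^+ 2 * A * (1 + A) * N%:R by ring.
by rewrite !lerD// ler_wpM2l.
Qed.

(** Since [residual i] is orthogonal to functions that are invariant under
    [flip i], only the odd part of the score contributes:
    [E phi^2 = 1/2 sum_i E (a_i (phi - phi o flip_i))]. *)
Lemma score_second_moment :
  \sum_x expR (beta * hamiltonian J x) * score x ^+ 2 <=
  score_bound * N%:R * \sum_x expR (beta * hamiltonian J x).
Proof.
have h2 : \sum_x expR (beta * hamiltonian J x) * score x ^+ 2 =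
  2^-1 * \sum_x expR (beta * hamiltonian J x) *
     \sum_i residual i x * (score x - score (flip i x)).
  rewrite mulr_sumr.
  (* Odd and even parts of the score with respect to each flip. *)
  have E x : expR (beta * hamiltonian J x) * score x ^+ 2 =
     2^-1 * (expR (beta * hamiltonian J x) *
          \sum_i residual i x * (score x - score (flip i x))) +
     2^-1 * (expR (beta * hamiltonian J x) *
          \sum_i residual i x * (score x + score (flip i x))).
    rewrite -mulrDr -mulrDr -big_split/=.
    under eq_bigr do rewrite -mulrDr addrACA addrC addNr add0r -mulr2n -mulr_natr mulrA.
    by rewrite -mulr_suml -mulr_suml -/(score x); field.
  under eq_bigr do rewrite E.
  rewrite big_split/= [X in _ + X = _](_ : _ = 0) ?addr0//.
  rewrite -mulr_sumr; under eq_bigr do rewrite mulr_sumr.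
  rewrite exchange_big big1 ?mulr0//= => i _.
  under eq_bigr do rewrite mulrA.
  by apply: residual_orthogonal => x; rewrite flipK addrC.
rewrite h2 mulr_sumr mulr_sumr; apply: ler_sum => x _.
have h3 := flip_increment x.
rewrite mulrCA [_ * expR _]mulrC; apply: ler_wpM2l; first exact: expR_ge0.
lra.
Qed.

End second_moment.

(** * From bounds on the tensor to consistency *)

Section mpl_root.
Context {R : realType} {q N : nat}.
Notation p := q.+2.
Variable J : p.-tuple 'I_N -> R.
Variables (beta A eps : R) (x : {ffun 'I_N -> bool}).
Hypotheses (beta_gt0 : 0 < beta) (A_gt0 : 0 < A) (eps_gt0 : 0 < eps).
Hypothesis m2 : \sum_i local_field J i x ^+ 2 <= A * N%:R.
Hypothesis Hx : eps * N%:R <= hamiltonian J x.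
Notation m i := (local_field J i x).

(* With this threshold the fields above [K] account for at most [eps N / 4] of
   the energy. *)
Let K : R := 4 * A / eps.

Let K_gt0 : 0 < K. Proof. by rewrite divr_gt0// mulr_gt0. Qed.

(** The energy is at most [sum_i |m_i|].  Fields above [K] contribute little since
    [|m_i| <= m_i^2 / K] there, and below [K] the inequality
    [|m| <= eps / 4 + m^2 / eps] trades energy for squares. *)
Lemma bulk_local_field :
  eps ^+ 2 / 2 * N%:R <= \sum_(i | `|m i| <= K) m i ^+ 2.
Proof.
have h i : `|m i| <= eps / 4 + (if `|m i| <= K then m i ^+ 2 else 0) / eps
                   + m i ^+ 2 / K.
  rewrite -[m i ^+ 2]real_normK ?num_real//.
  have := normr_ge0 (m i); move: `|m i| => t t0.
  case: ifPn => [_|].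
    apply: (@le_trans _ _ (eps / 4 + t ^+ 2 / eps)); last first.
      by rewrite lerDl divr_ge0 ?sqr_ge0 ?ltW.
    rewrite -(ler_pM2r eps_gt0) mulrDl divfK ?gt_eqF//.
    by have := sqr_ge0 (t - eps / 2); rewrite !expr2; lra.
  rewrite -ltNge => Kt; rewrite mul0r addr0.
  apply: (@le_trans _ _ (t ^+ 2 / K)); last by rewrite lerDr divr_ge0 ?ltW.
  by rewrite ler_pdivlMr// expr2; apply: ler_wpM2l => //; exact: ltW.
have : \sum_i `|m i| <= \sum_i (eps / 4 + (if `|m i| <= K then m i ^+ 2 else 0) / eps
                   + m i ^+ 2 / K) by apply: ler_sum => i _; exact: h.
rewrite !big_split/= -!mulr_suml -big_mkcond/= sumr_const card_ord -(mulr_natr eps).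
have Hm : hamiltonian J x <= \sum_i `|m i|.
  rewrite hamiltonian_sum; apply: ler_sum => i _.
  by apply: le_trans (ler_norm _) _; rewrite normrM spin_normr mul1r.
have m2K : (\sum_i m i ^+ 2) / K <= eps / 4 * N%:R.
  rewrite ler_pdivrMr//; apply: (le_trans m2); rewrite /K.
  by rewrite le_eqVlt; apply/orP; left; apply/eqP; field; rewrite gt_eqF.
set S := \sum_(i < N | _ <= _) _ => h1.
have h2 : eps / 2 * N%:R <= S / eps.
  move: h1 Hm m2K Hx; move: (_ / K) (S / eps) (hamiltonian J x) => Q T H.
  by move: (\sum_i _) => B h1 h3 h4 h5; lra.
rewrite ler_pdivlMr// in h2.
by apply: le_trans h2; rewrite le_eqVlt; apply/orP; left; apply/eqP; field.
Qed.

(** The slope of the MPL equation per vertex: [p] times the lower bound of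
    [sech^2] for fields below [K] and [b <= beta + 1], times the mass found in
    [bulk_local_field]. *)
Definition slope_rate : R :=
  p%:R * expR (- (2 * (p%:R * (beta + 1) * K))) * (eps ^+ 2 / 2).

Lemma slope_rate_gt0 : 0 < slope_rate.
Proof. by rewrite !mulr_gt0 ?expR_gt0 ?invr_gt0 ?exprn_gt0 ?ltr0n. Qed.

Let f b := \sum_(i < N) m i * tanh (p%:R * b * m i).

Let f_mono b b' : b <= b' -> f b <= f b'.
Proof.
move=> bb'; apply: ler_sum => i _; rewrite -subr_ge0 -mulrBr.
by apply: tanh_mono; exact: ler_wpM2l.
Qed.

Let f_slope b b' : 0 <= b -> b <= b' -> b' <= beta + 1 ->
  slope_rate * N%:R * (b' - b) <= f b' - f b.
Proof.
move=> b0 bb' b'1; rewrite -sumrB.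
have -> : slope_rate * N%:R * (b' - b) =
    p%:R * expR (- (2 * (p%:R * (beta + 1) * K))) * (b' - b) *
    (eps ^+ 2 / 2 * N%:R) by rewrite /slope_rate; ring.
have c0 : 0 <= p%:R * expR (- (2 * (p%:R * (beta + 1) * K))) * (b' - b).
  by rewrite !mulr_ge0 ?expR_ge0 ?subr_ge0.
apply: le_trans (ler_wpM2l c0 bulk_local_field) _.
rewrite mulr_sumr big_mkcond; apply: ler_sum => i _.
rewrite -mulrBr; case: ifPn => [mK|_]; last by apply: tanh_mono; exact: ler_wpM2l.
have hl (a : R) : 0 <= a -> a <= beta + 1 -> `|p%:R * a * m i| <= p%:R * (beta + 1) * K.
  move=> a0 a1; rewrite !normrM (ger0_norm (ler0n _ _)) (ger0_norm a0) -!mulrA.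
  by apply: ler_wpM2l => //; apply: ler_pM.
have pbb : p%:R * b <= p%:R * b' :> R by exact: ler_wpM2l.
apply: le_trans (tanh_slope pbb (hl _ b0 (le_trans bb' b'1)) (hl _ (le_trans b0 bb') b'1)).
by rewrite le_eqVlt; apply/orP; left; apply/eqP; ring.
Qed.

Let f_cont : continuous f.
Proof.
suff h i : continuous (fun b : R => m i * tanh (p%:R * b * m i)).
  exact: (continuous_big (@add_continuous R) (fun i _ => h i) (x0 := 0)).
move=> b; apply: cvgM; first exact: cvg_cst.
apply: (@continuous_comp _ _ _ (fun b : R => p%:R * b * m i) (@tanh R)).
  by apply: cvgM; [apply: cvgM; [exact: cvg_cst|exact: cvg_id]|exact: cvg_cst].
exact: continuous_tanh.
Qed.

(** [f] is nondecreasing and has slope at least [slope_rate * N] up to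
    [beta + 1].  Hence it crosses the value [H] within [r] of [beta], and it is
    strictly below [H] before [beta - r], so that no smaller root competes in the
    infimum. *)
Lemma mpl_close (r : R) : 0 <= r -> r <= beta -> r <= 1 -> (0 < N)%N ->
  `|score J beta x| <= slope_rate * N%:R * r ->
  (`|mpl J x - beta%:E| <= r%:E)%E.
Proof.
move=> r0 rb r1 N0 sr.
have sE : score J beta x = hamiltonian J x - f beta.
  rewrite /score hamiltonian_sum -sumrB; apply: eq_bigr => i _.
  by rewrite /residual; ring.
move: sr; rewrite sE ler_norml => /andP[s1 s2].
have hi : hamiltonian J x <= f (beta + r).
  have := @f_slope beta (beta + r) (ltW beta_gt0).
  rewrite lerDl lerD2l => /(_ r0 r1).
  by rewrite (addrC beta) addrK; lra.
have lo : f (beta - r) <= hamiltonian J x.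
  have := @f_slope (beta - r) beta.
  rewrite subr_ge0 gerBl lerDl ler01 => /(_ rb r0 isT).
  by rewrite opprB addrCA subrr addr0; lra.
have [b /[!in_itv]/= /andP[b1 b2] fb] : exists2 b, b \in `[beta - r, beta + r]
    & f b = hamiltonian J x.
  apply: IVT; first by lra.
    exact: continuous_subspaceT.
  have := le_trans lo hi => lohi.
  by rewrite (min_idPl lohi) (max_idPr lohi) lo hi.
have ub : (mpl J x <= (beta + r)%:E)%E.
  apply: (@le_trans _ _ b%:E); last by rewrite lee_fin.
  apply: ereal_inf_lbound; exists b => //=; split; last by rewrite -fb.
  by apply: le_trans b1; rewrite subr_ge0.
have lb : ((beta - r)%:E <= mpl J x)%E.
  apply: le_ereal_inf_tmp => _ [b' [b'0 Hb'] <-]; rewrite lee_fin leNgt.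
  apply/negP => b'lt.
  have h1 : beta - r <= beta + 1 by lra.
  have := f_slope b'0 (ltW b'lt) h1.
  have : 0 < slope_rate * N%:R * (beta - r - b').
    apply: mulr_gt0; last by rewrite subr_gt0.
    by apply: mulr_gt0; [exact: slope_rate_gt0|rewrite ltr0n].
  by rewrite /f -Hb' -/(f _); lra.
case: (mpl J x) ub lb => [y| |] //.
rewrite !lee_fin => y1 y2.
rewrite ler_norml.
by apply/andP; split; lra.
Qed.

End mpl_root.

Section consistency.
Context {R : realType} {q : nat}.
Notation p := q.+2.
Variable J : forall N, p.-tuple 'I_N -> R.
Hypothesis symJ : forall N (t t' : p.-tuple 'I_N), perm_eq t t' -> J t = J t'.
Hypothesis diagJ : forall N (t : p.-tuple 'I_N), ~~ uniq t -> J t = 0.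

Let gibbs N (x : {ffun 'I_N -> bool}) beta : R :=
  expR (beta * hamiltonian (@J N) x).

Let ising_probE N beta (A : pred {ffun 'I_N -> bool}) :
  ising_prob (@J N) beta A =
  (\sum_(x : {ffun 'I_N -> bool} | A x) gibbs x beta) /
  \sum_(x : {ffun 'I_N -> bool}) gibbs x beta.
Proof.
rewrite mulrC mulr_sumr; apply: eq_bigr => x _.
by rewrite /ising_pmf /partition_fun mulrA mulfV ?mul1r.
Qed.

(** Two kinds of configurations are discarded.  Those of energy below [eps N]
    have total weight at most [2^N e^(beta eps N)], negligible before the
    partition function when [eps = kappa / (2 beta)].  Those with a large score
    are rare by Chebyshev's inequality and [score_second_moment]. *)
Lemma mpl_consistency (beta A kappa : R) : 0 < beta -> 0 < A -> 0 < kappa ->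
  (\forall N \near \oo, [/\ forall x y : {ffun 'I_N -> bool},
     \sum_i bform (@J N) (basis i) (spin y) x ^+ 2 <= A * N%:R,
   forall (x : {ffun 'I_N -> bool}) i,
     \sum_j bform (@J N) (basis j) (basis i) x ^+ 2 <= A &
   2 ^+ N * expR (kappa * N%:R) <= \sum_(x : {ffun 'I_N -> bool}) gibbs x beta]) ->
  mpl_sqrt_consistent J beta.
Proof.
move=> beta0 A0 kappa0 near_bounds delta delta0.
pose eps := kappa / (2 * beta).
have eps0 : 0 < eps by rewrite divr_gt0// mulr_gt0.
have [c cE] : exists c, slope_rate (q := q) beta A eps = c by eexists.
have c0 : 0 < c by rewrite -cE; exact: slope_rate_gt0.
have [sb sbE] : exists sb, score_bound (q := q) beta A = sb by eexists.
have sb0 : 0 < sb.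
  by rewrite -sbE /score_bound; rewrite !addr_gt0// ?mulr_gt0// ?ltr0n// ?exprn_gt0// addr_gt0.
pose M := Num.sqrt (4 * sb / (delta * c ^+ 2)).
have M0 : 0 < M by rewrite sqrtr_gt0 divr_gt0 ?mulr_gt0.
exists M => //.
near=> N.
have [B1 B2 ZB] : [/\ forall x y : {ffun 'I_N -> bool},
     \sum_i bform (@J N) (basis i) (spin y) x ^+ 2 <= A * N%:R,
   forall (x : {ffun 'I_N -> bool}) i,
     \sum_j bform (@J N) (basis j) (basis i) x ^+ 2 <= A &
   2 ^+ N * expR (kappa * N%:R) <= \sum_(x : {ffun 'I_N -> bool}) gibbs x beta].
  by near: N.
have N0 : (0 < N)%N by near: N; exact: nbhs_infty_gt.
have Nr0 : 0 < N%:R :> R by rewrite ltr0n.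
have sN0 : 0 < Num.sqrt (N%:R : R) by rewrite sqrtr_gt0.
pose r := M / Num.sqrt N%:R.
have rle : r <= Num.min beta 1.
  rewrite /r ler_pdivrMr//.
  have b1 : 0 < Num.min beta 1 by rewrite lt_min beta0 ltr01.
  rewrite mulrC -ler_pdivrMr//.
  have -> : M / Num.min beta 1 = Num.sqrt ((M / Num.min beta 1) ^+ 2).
    by rewrite sqrtr_sqr ger0_norm// divr_ge0 ?ltW.
  rewrite ler_sqrt//.
  by near: N; exact: nbhs_infty_ger.
have r_gt0 : 0 < r by rewrite divr_gt0.
have cNr : 0 < c * N%:R * r by apply: mulr_gt0 => //; apply: mulr_gt0.
have expd : expR (- (kappa / 2 * N%:R)) < delta / 2.
  rewrite -ltf_pV2 ?posrE ?expR_gt0 ?divr_gt0// -expRN opprK.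
  apply: (@lt_le_trans _ _ (1 + kappa / 2 * N%:R)); last exact: expR_ge1Dx.
  apply: (@le_lt_trans _ _ (kappa / 2 * N%:R)); last by rewrite ltrDr.
  rewrite -ler_pdivrMl ?divr_gt0//.
  by near: N; exact: nbhs_infty_ger.
set Z := \sum_(x : {ffun 'I_N -> bool}) gibbs x beta in ZB.
have Z0 : 0 < Z.
  by apply: lt_le_trans ZB; rewrite mulr_gt0 ?expR_gt0// exprn_gt0.
pose good := fun x : {ffun 'I_N -> bool} =>
  ((Num.sqrt N%:R)%:E * `|mpl (@J N) x - beta%:E| <= M%:E)%E.
have goodP x : eps * N%:R <= hamiltonian (@J N) x ->
    score (@J N) beta x ^+ 2 <= (c * N%:R * r) ^+ 2 -> good x.
  move=> Hx sx; rewrite /good.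
  have m2 := sum_local_field_sqr B1 x.
  have r0 : 0 <= r by rewrite divr_ge0 ?ltW.
  move: rle; rewrite le_min => /andP[rb r1].
  have := @mpl_close R q N (@J N) beta A eps x beta0 A0 eps0 m2 Hx r r0 rb r1 N0.
  rewrite cE => h.
  have : `|score (J (N:=N)) beta x| <= c * N%:R * r.
    rewrite -(@ler_pXn2r _ 2)// ?nnegrE// ?real_normK ?num_real//.
    by apply: mulr_ge0 => //; apply: mulr_ge0; exact: ltW.
  move=> /h {}h; apply: le_trans (lee_wpmul2l _ h) _; first by rewrite lee_fin ltW.
  by rewrite -EFinM /r mulrCA mulfV ?mulr1// gt_eqF.
rewrite ising_probE -/Z ltr_pdivlMr//.
have split_good : Z <= \sum_(x | good x) gibbs x beta +
   (\sum_(x | hamiltonian (@J N) x < eps * N%:R) gibbs x beta +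
    \sum_(x : {ffun 'I_N -> bool}) gibbs x beta * score (@J N) beta x ^+ 2 / (c * N%:R * r) ^+ 2).
  rewrite /Z !(big_mkcond good) (big_mkcond (fun x => _ < _)) -!big_split/=.
  apply: ler_sum => x _.
  have g0 : 0 <= gibbs x beta by exact: expR_ge0.
  have t0 : 0 <= gibbs x beta * score (@J N) beta x ^+ 2 / (c * N%:R * r) ^+ 2.
    by rewrite divr_ge0 ?sqr_ge0// mulr_ge0 ?sqr_ge0.
  have [Hx|Hx] := ltP (hamiltonian (@J N) x) (eps * N%:R).
    by case: ifP => _; lra.
  have [sx|sx] := leP (score (@J N) beta x ^+ 2) ((c * N%:R * r) ^+ 2).
    by rewrite goodP//; lra.
  have : gibbs x beta <= gibbs x beta * score (@J N) beta x ^+ 2 / (c * N%:R * r) ^+ 2.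
    rewrite -mulrA ler_peMr// ler_pdivlMr ?mul1r ?ltW//.
    exact: exprn_gt0.
  by case: ifP => _; lra.
have low : \sum_(x | hamiltonian (@J N) x < eps * N%:R) gibbs x beta < delta / 2 * Z.
  apply: (@le_lt_trans _ _ (expR (- (kappa / 2 * N%:R)) * Z)); last by rewrite ltr_pM2r.
  apply: (@le_trans _ _ (expR (- (kappa / 2 * N%:R)) * (2 ^+ N * expR (kappa * N%:R)))).
    rewrite mulrCA -expRD.
    have -> : - (kappa / 2 * N%:R) + kappa * N%:R = beta * (eps * N%:R).
      by rewrite /eps; field; rewrite gt_eqF.
    apply: (@le_trans _ _ (\sum_(x : {ffun 'I_N -> bool}) expR (beta * (eps * N%:R)))).
      rewrite big_mkcond; apply: ler_sum => x _; case: ifPn => [Hx|_]; last exact: expR_ge0.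
      by rewrite ler_expR ler_pM2l// ltW.
    by rewrite sumr_const card_ffun card_bool card_ord -[leLHS]mulr_natl natrX.
  by rewrite ler_pM2l ?expR_gt0.
have high : \sum_x gibbs x beta * score (@J N) beta x ^+ 2 / (c * N%:R * r) ^+ 2
    <= delta / 4 * Z.
  rewrite -mulr_suml ler_pdivrMr; last first.
    exact: exprn_gt0.
  have := score_second_moment (@symJ N) (@diagJ N) (ltW beta0) B1 B2.
  rewrite sbE => h; apply: (le_trans h).
  rewrite le_eqVlt; apply/orP; left; apply/eqP.
  have -> : (c * N%:R * r) ^+ 2 = c ^+ 2 * N%:R * M ^+ 2.
    rewrite /r !exprMn exprVn (sqr_sqrtr (ler0n R N)).
    by field; rewrite gt_eqF.
  rewrite /M sqr_sqrtr; last by rewrite divr_ge0 ?mulr_ge0 ?sqr_ge0 ?ltW.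
  rewrite -/Z.
  by field; rewrite !gt_eqF.
have : 0 < delta / 4 * Z by rewrite mulr_gt0// divr_gt0.
lra.
Unshelve. all: by end_near.
Qed.

End consistency.

(** * A variational lower bound for the partition function *)

Section cube_averages.
Context {R : realType} {N : nat}.
Implicit Types (x y : {ffun 'I_N -> bool}) (S : pred 'I_N).

Lemma sum_cube_cst (c : R) : \sum_(x : {ffun 'I_N -> bool}) c = 2 ^+ N * c.
Proof.
by rewrite sumr_const card_ffun card_bool card_ord -(mulr_natl c) natrX.
Qed.

Lemma sum_cube_prod (G : 'I_N -> bool -> R) :
  \sum_(x : {ffun 'I_N -> bool}) \prod_i G i (x i) =
  \prod_i (G i true + G i false).
Proof.
by rewrite -bigA_distr_bigA; apply: eq_bigr => i _; rewrite big_bool.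
Qed.

Lemma prod_uniq_mem (t : seq 'I_N) (F : 'I_N -> R) : uniq t ->
  \prod_(j <- t) F j = \prod_i (if i \in t then F i else 1).
Proof. by move=> ut; rewrite big_uniq// big_mkcond. Qed.

(** The characters of the group [{-1, 1}^N]. *)
Definition parity S x : R := \prod_(i | S i) spin x i.

Lemma parity_orthogonal S S' :
  \sum_x parity S x * parity S' x =
  if [forall i, S i == S' i] then 2 ^+ N else 0.
Proof.
pose G i (b : bool) : R := (if S i then (if b then 1 else -1) else 1) *
                           (if S' i then (if b then 1 else -1) else 1).
transitivity (\sum_(x : {ffun 'I_N -> bool}) \prod_i G i (x i)).
  apply: eq_bigr => x _; rewrite /parity !(big_mkcond S) !(big_mkcond S').
  by rewrite -big_split.
rewrite sum_cube_prod; case: ifPn => [/forallP SS|].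
  rewrite (eq_bigr (fun=> 2)) ?prodr_const ?card_ord// => i _.
  by rewrite /G (eqP (SS i)); case: (S' i); ring.
rewrite negb_forall => /existsP[i Si].
rewrite (bigD1 i)//= [X in X * _](_ : _ = 0) ?mul0r//.
by rewrite /G; move: Si; case: (S i); case: (S' i) => // _; ring.
Qed.

End cube_averages.

Section variational.
Context {R : realType} {q N : nat}.
Notation p := q.+2.
Variable J : p.-tuple 'I_N -> R.
Hypothesis symJ : forall t t' : p.-tuple 'I_N, perm_eq t t' -> J t = J t'.
Hypothesis diagJ : forall t : p.-tuple 'I_N, ~~ uniq t -> J t = 0.
Variable B : pred 'I_N.
Implicit Types (x y : {ffun 'I_N -> bool}).

(** The spins outside [B], extended by zero, which suppresses every coupling
    with a second index in [B]. *)
Definition outer x i : R := if B i then 0 else spin x i.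

(** The field created at [i] by the spins outside [B]. *)
Definition cavity x i : R := mform J (set_slot ord0 (basis i) (fun=> outer x)).

Definition cavity_sign x i : R :=
  if B i then (if 0 <= cavity x i then 1 else -1) else 0.

Definition glue x y : {ffun 'I_N -> bool} := [ffun i => if B i then y i else x i].

(** [glue x y] and [glue y x] determine [x] and [y]: exchanging the two outer
    parts is an involution on pairs, so [glue x y] is uniform. *)
Lemma sum_glue (F : {ffun 'I_N -> bool} -> R) :
  \sum_x \sum_y F (glue x y) = 2 ^+ N * \sum_x F x.
Proof.
rewrite pair_big /=.
pose h (u : {ffun 'I_N -> bool} * {ffun 'I_N -> bool}) :=
  (glue u.1 u.2, glue u.2 u.1).
have hK : involutive h.
  move=> [x y]; rewrite /h /=; congr pair; apply/ffunP => i; rewrite !ffunE;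
  by case: (B i).
transitivity (\sum_(u : {ffun 'I_N -> bool} * {ffun 'I_N -> bool}) F u.1).
  rewrite [RHS](reindex_inj (can_inj hK))/=; apply: eq_bigr => u _ //.
rewrite -(pair_big predT predT (fun x _ => F x))/= mulr_sumr.
by apply: eq_bigr => x _; rewrite sum_cube_cst.
Qed.

Variable s : R.
Hypotheses (s0 : 0 <= s) (s1 : s <= 1).

Let e x i := s * cavity_sign x i.

(** Density, with respect to the uniform law, of independent spins [y] with
    means [e x i]; it depends on [x] only through the spins outside [B]. *)
Definition tilt x y : R := \prod_i (1 + e x i * spin y i).

Definition tilt_mean x i : R := outer x i + e x i.

(** Under the trial law distinct spins are independent, so the mean of a
    multilinear monomial is the monomial of the means. *)
Lemma sum_tilt x (t : seq 'I_N) : uniq t ->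
  \sum_y tilt x y * \prod_(j <- t) spin (glue x y) j =
  2 ^+ N * \prod_(j <- t) tilt_mean x j.
Proof.
move=> ut; pose sg (b : bool) : R := if b then 1 else -1.
pose G i b := (1 + e x i * sg b) *
   (if i \in t then (if B i then sg b else spin x i) else 1).
transitivity (\sum_(y : {ffun 'I_N -> bool}) \prod_i G i (y i)).
  apply: eq_bigr => y _; rewrite /tilt prod_uniq_mem// -big_split/=.
  apply: eq_bigr => i _; rewrite /G; congr (_ * _); case: ifP => // _.
  by rewrite [in LHS]/spin ffunE; case: (B i).
rewrite sum_cube_prod prod_uniq_mem//.
have -> : 2 ^+ N = \prod_(i < N) 2 :> R by rewrite prodr_const card_ord.
rewrite -big_split/=; apply: eq_bigr => i _.
rewrite /G /tilt_mean /outer /e /sg /cavity_sign.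
by case: (i \in t); case: (B i) => /=; ring.
Qed.

Lemma sum_tilt_mform x :
  \sum_y tilt x y * hamiltonian J (glue x y) =
  2 ^+ N * mform J (fun=> tilt_mean x).
Proof.
rewrite /hamiltonian; under eq_bigr do rewrite mulr_sumr.
rewrite exchange_big /mform mulr_sumr; apply: eq_bigr => t _ /=.
have [ut|/diagJ ->] := boolP (uniq t); last first.
  by rewrite mul0r mulr0 big1// => y _; rewrite mul0r mulr0.
under eq_bigr do rewrite mulrCA.
by rewrite -mulr_sumr sum_tilt// big_tuple mulrCA.
Qed.

Let e_le1 x i : `|e x i| <= 1.
Proof.
rewrite normrM (ger0_norm s0) /cavity_sign.
apply: (@le_trans _ _ (1 * 1)); last by rewrite mulr1.
apply: ler_pM => //; case: ifP => _; last by rewrite normr0.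
by case: ifP => _; rewrite ?normrN normr1.
Qed.

Let tilt_factor_ge0 x y i : 0 <= 1 + e x i * spin y i.
Proof.
have : `|e x i * spin y i| <= 1 by rewrite normrM spin_normr mulr1.
rewrite ler_norml => /andP[]; lra.
Qed.

Lemma tilt_ge0 x y : 0 <= tilt x y.
Proof. exact: prodr_ge0. Qed.

Lemma tilt_le_exp x y : tilt x y <= expR (\sum_i e x i * spin y i).
Proof.
rewrite expR_sum; apply: ler_prod => i _.
by rewrite tilt_factor_ge0 expR_ge1Dx.
Qed.

Lemma sum_tilt_entropy x :
  \sum_y tilt x y * (\sum_i e x i * spin y i) <= 2 ^+ N * (s ^+ 2 * N%:R).
Proof.
under eq_bigr do rewrite mulr_sumr.
rewrite exchange_big/=.
apply: (@le_trans _ _ (\sum_(i < N) 2 ^+ N * s ^+ 2)); last first.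
  by rewrite sumr_const card_ord -(mulr_natr (2 ^+ N * s ^+ 2)) mulrA.
apply: ler_sum => i _.
have [Bi|nBi] := boolP (B i); last first.
  rewrite big1 ?mulr_ge0 ?sqr_ge0 ?exprn_ge0// => y _.
  by rewrite /e /cavity_sign (negbTE nBi) mulr0 mul0r mulr0.
have E : \sum_y tilt x y * spin (glue x y) i = 2 ^+ N * tilt_mean x i.
  have := @sum_tilt x [:: i] isT; rewrite big_seq1 => <-.
  by apply: eq_bigr => y _; rewrite big_seq1.
under eq_bigr do rewrite mulrCA.
rewrite -mulr_sumr.
rewrite (eq_bigr (fun y => tilt x y * spin (glue x y) i)); last first.
  by move=> y _; rewrite /spin ffunE Bi.
rewrite E mulrCA ler_pM2l ?exprn_gt0// /tilt_mean /outer Bi add0r -expr2.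
rewrite -[e x i ^+ 2]real_normK ?num_real// lerXn2r ?nnegrE//.
rewrite /e normrM (ger0_norm s0) ler_piMr// /cavity_sign Bi.
by case: ifP => _; rewrite ?normrN normr1.
Qed.

(** Gibbs' variational principle without logarithms: the density is at most
    [exp (sum_i e_i y_i)], whose exponent has mean at most [s^2 N] and bounds the
    entropy, and Jensen's inequality is the tangent bound
    [e^v >= e^a (1 + v - a)] at the mean [a] of [v]. *)
Lemma variational_lb (beta : R) : 0 <= beta ->
  2 ^+ N * expR (beta * ((2 ^+ N)^-1 * \sum_x mform J (fun=> tilt_mean x))
                 - s ^+ 2 * N%:R) <=
  \sum_x expR (beta * hamiltonian J x).
Proof.
move=> beta0; set a := _ - _.
have P0 : 0 < 2 ^+ N :> R by rewrite exprn_gt0.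
rewrite -(ler_pM2l P0) -sum_glue.
pose v x y := beta * hamiltonian J (glue x y) - \sum_i e x i * spin y i.
apply: (@le_trans _ _ (\sum_x \sum_y tilt x y * (expR a * (1 + (v x y - a))))).
  have tot : \sum_x \sum_y tilt x y = 2 ^+ N * 2 ^+ N.
    rewrite (eq_bigr (fun=> 2 ^+ N)) => [|x _].
      by rewrite sum_cube_cst.
    have := @sum_tilt x [::] isT; rewrite big_nil mulr1 => <-.
    by apply: eq_bigr => y _; rewrite big_nil mulr1.
  have -> : \sum_x \sum_y tilt x y * (expR a * (1 + (v x y - a))) =
     expR a * ((1 - a) * (2 ^+ N * 2 ^+ N) +
       (beta * \sum_x \sum_y tilt x y * hamiltonian J (glue x y) -
        \sum_x \sum_y tilt x y * (\sum_i e x i * spin y i))).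
    rewrite -tot !mulr_sumr -!(sumrB, big_split)/= mulr_sumr; apply: eq_bigr => x _.
    rewrite !mulr_sumr -!(sumrB, big_split)/= mulr_sumr; apply: eq_bigr => y _.
    by rewrite /v; ring.
  have h1 : \sum_x \sum_y tilt x y * hamiltonian J (glue x y) =
      2 ^+ N * \sum_x mform J (fun=> tilt_mean x).
    by rewrite mulr_sumr; apply: eq_bigr => x _; exact: sum_tilt_mform.
  have h2 : \sum_x \sum_y tilt x y * (\sum_i e x i * spin y i) <=
      2 ^+ N * 2 ^+ N * (s ^+ 2 * N%:R).
    apply: le_trans (ler_sum _ (fun x _ => sum_tilt_entropy x)) _.
    by rewrite sum_cube_cst mulrA.
  have -> : 2 ^+ N * (2 ^+ N * expR a) = expR a * (2 ^+ N * 2 ^+ N) by ring.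
  apply: ler_wpM2l; first exact: expR_ge0.
  have ha : a * (2 ^+ N * 2 ^+ N) = beta * (2 ^+ N * \sum_x mform J (fun=> tilt_mean x))
     - 2 ^+ N * 2 ^+ N * (s ^+ 2 * N%:R).
    by rewrite /a; field; rewrite gt_eqF.
  rewrite h1 mulrBl mul1r ha; lra.
apply: ler_sum => x _; apply: ler_sum => y _.
apply: (@le_trans _ _ (tilt x y * expR (v x y))).
  apply: ler_wpM2l; first exact: tilt_ge0.
  rewrite [in leRHS](_ : v x y = a + (v x y - a)); last by ring.
  rewrite (expRD a (v x y - a)).
  by rewrite ler_pM2l ?expR_gt0// expR_ge1Dx.
rewrite /v expRD expRN mulrCA ler_piMr ?expR_ge0//.
by rewrite ler_pdivrMr ?expR_gt0// mul1r tilt_le_exp.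
Qed.

End variational.

Section second_order_expansion.
Context {R : realType} {p N : nat}.
Variable J : p.-tuple 'I_N -> R.

Lemma mform_add_expand (a e : 'I_N -> R) (s : R) :
  mform J (fun=> fun i => a i + s * e i) =
  \sum_(f : {ffun 'I_p -> bool})
     (\prod_j (if f j then s else 1)) * mform J (fun j => if f j then e else a).
Proof.
rewrite /mform; under [RHS]eq_bigr do rewrite mulr_sumr.
rewrite exchange_big; apply: eq_bigr => t _ /=.
pose F (j : 'I_p) (b : bool) : R := if b then s * e (tnth t j) else a (tnth t j).
rewrite (eq_bigr (fun j => \sum_b F j b)); last first.
  by move=> j _; rewrite big_bool /F addrC.
rewrite bigA_distr_bigA mulr_sumr; apply: eq_bigr => f _.
rewrite mulrCA -big_split/=; congr (_ * _); apply: eq_bigr => j _.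
by rewrite /F; case: (f j); rewrite ?mul1r.
Qed.

(** In the expansion of the form along [a + s e], the terms with no or one slot
    equal to [e] are kept; each of the others, at most [2^p] in number, carries
    a factor [s^2]. *)
Lemma mform_second_order (a e : 'I_N -> R) (s C : R) : 0 <= s -> s <= 1 ->
  (forall u : 'I_p -> 'I_N -> R, (forall j, u j = a \/ u j = e) ->
     `|mform J u| <= C) ->
  mform J (fun=> a) + s * (\sum_l mform J (set_slot l e (fun=> a)))
    - 2 ^+ p * (s ^+ 2 * C) <=
  mform J (fun=> fun i => a i + s * e i).
Proof.
move=> s0 s1 uC; rewrite mform_add_expand.
have C0 : 0 <= C by apply: le_trans (uC (fun=> a) _); [exact: normr_ge0|left].
pose f0 : {ffun 'I_p -> bool} := [ffun=> false].
pose d (l : 'I_p) : {ffun 'I_p -> bool} := [ffun j => j == l].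
have -> : mform J (fun=> a) + s * (\sum_l mform J (set_slot l e (fun=> a)))
    - 2 ^+ p * (s ^+ 2 * C) =
  \sum_(f : {ffun 'I_p -> bool}) ((f == f0)%:R * mform J (fun=> a) +
    (\sum_l (f == d l)%:R * (s * mform J (set_slot l e (fun=> a)))) - s ^+ 2 * C).
  rewrite sumrB big_split/= -mulr_suml [X in _ = _ + X - _]exchange_big/=.
  have E (g : {ffun 'I_p -> bool}) : \sum_f (f == g)%:R = 1 :> R.
    by rewrite (bigD1 g)//= eqxx big1 ?addr0// => f /negbTE ->.
  rewrite E mul1r (sum_cube_cst (s ^+ 2 * C)) mulr_sumr; congr (_ + _ - _).
  by apply: eq_bigr => l _; rewrite -mulr_suml E mul1r.
apply: ler_sum => f _.
have sC0 : 0 <= s ^+ 2 * C by rewrite mulr_ge0 ?sqr_ge0.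
have dj l : d l l by rewrite ffunE.
case: (pickP f) => [j fj|fno]; last first.
  have -> : f = f0 by apply/ffunP => j; rewrite ffunE; exact: fno.
  rewrite eqxx mul1r [X in _ + X - _]big1 => [|l _]; last first.
    case: eqP => [E|_]; last by rewrite mul0r.
    by have := dj l; rewrite -E ffunE.
  rewrite big1 => [|j _]; last by rewrite ffunE.
  rewrite mul1r addr0 (eq_mform _ (z2 := fun=> a)); first by rewrite lerBlDr lerDl.
  by move=> j i; rewrite ffunE.
have ff0 : f == f0 = false by apply/eqP => E; move: fj; rewrite E ffunE.
rewrite ff0 mul0r add0r.
case: (pickP (fun k => f k && (k != j))) => [k /andP[fk kj]|fno].
  rewrite big1 => [|l _]; last first.
    case: eqP => [E|_]; last by rewrite mul0r.
    by move: fj fk kj; rewrite E !ffunE => /eqP -> /eqP ->; rewrite eqxx.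
  rewrite sub0r lerNl; apply: le_trans (ler_norm _) _.
  rewrite normrN normrM; apply: ler_pM => //.
    rewrite ger0_norm; last by apply: prodr_ge0 => l _; case: ifP.
    rewrite (bigD1 j)//= fj (bigD1 k)//= fk mulrA -expr2 ler_piMr ?sqr_ge0//.
    by apply: prodr_ile1 => l _; case: ifP => _; rewrite ?s0 ?ler01 ?lexx ?s1.
  by apply: uC => l; case: (f l); [right|left].
have -> : f = d j.
  apply/ffunP => k; rewrite ffunE; have := fno k.
  by case: (eqVneq k j) => [->|_]; rewrite ?fj// andbT.
rewrite (bigD1 j)//= eqxx mul1r big1 ?addr0 => [|l lj]; last first.
  case: eqP => [E|_]; last by rewrite mul0r.
  by have := dj j; rewrite E ffunE eq_sym (negbTE lj).
have -> : \prod_j0 (if d j j0 then s else 1) = s.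
  rewrite (bigD1 j)//= dj big1 ?mulr1// => l /negbTE lj.
  by rewrite ffunE lj.
rewrite (eq_mform _ (z2 := set_slot j e (fun=> a))); first by rewrite lerBlDr lerDl.
by move=> k i; rewrite ffunE /set_slot.
Qed.

End second_order_expansion.

Section free_energy.
Context {R : realType} {q N : nat}.
Notation p := q.+2.
Variable J : p.-tuple 'I_N -> R.
Hypothesis symJ : forall t t' : p.-tuple 'I_N, perm_eq t t' -> J t = J t'.
Hypothesis diagJ : forall t : p.-tuple 'I_N, ~~ uniq t -> J t = 0.
Variable B : pred 'I_N.
Implicit Types (x y : {ffun 'I_N -> bool}).

(** Each monomial with distinct indices outside [B] is a nontrivial character. *)
Lemma sum_mform_outer : \sum_x mform J (fun=> outer B x) = 0.
Proof.
rewrite /mform exchange_big big1//= => t _.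
have [ut|/diagJ ->] := boolP (uniq t); last by rewrite big1// => x _; rewrite mul0r.
rewrite -mulr_sumr; apply/eqP; rewrite mulf_eq0; apply/orP; right; apply/eqP.
pose G i (b : bool) : R := if i \in val t then
  (if B i then 0 else if b then 1 else -1) else 1.
transitivity (\sum_(x : {ffun 'I_N -> bool}) \prod_i G i (x i)).
  apply: eq_bigr => x _.
  by rewrite -(big_tuple _ _ t predT (fun j => outer B x j)) prod_uniq_mem.
rewrite sum_cube_prod (bigD1 (thead t))//= [X in X * _](_ : _ = 0) ?mul0r//.
rewrite /G mem_tnth; case: (B _); ring.
Qed.

Lemma sum_slots_cavity x :
  \sum_l mform J (set_slot l (cavity_sign J B x) (fun=> outer B x)) =
  p%:R * \sum_(i | B i) `|cavity J B x i|.
Proof.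
rewrite (eq_bigr (fun=> \sum_(i | B i) `|cavity J B x i|)) => [|l _].
  by rewrite sumr_const card_ord -(mulr_natl (\sum_(i | B i) _)).
rewrite (mform_slot_any symJ l ord0) mform_slot_sum [RHS]big_mkcond.
apply: eq_bigr => i _; rewrite -/(cavity J B x i) /cavity_sign.
case: (B i); last by rewrite mul0r.
case: ifPn => [c0|]; first by rewrite mul1r ger0_norm.
by rewrite -ltNge => c0; rewrite mulN1r ltr0_norm.
Qed.

(** Sign vectors and their restrictions to sets of indices. *)
Definition ternary (u : 'I_N -> R) := forall i, u i = 0 \/ u i = 1 \/ u i = -1.

(** The linear gain is [p] times the sum of the absolute cavity fields because the
    sign of each field is the mean chosen for its spin. *)
Lemma free_energy_lb (beta C c s : R) : 0 <= beta -> 0 <= s -> s <= 1 ->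
  (forall u : 'I_p -> 'I_N -> R, (forall j, ternary (u j)) ->
    `|mform J u| <= C * N%:R) ->
  2 ^+ N * (c * N%:R) <= \sum_x \sum_(i | B i) `|cavity J B x i| ->
  2 ^+ N * expR ((beta * (s * (p%:R * c) - 2 ^+ p * (s ^+ 2 * C)) - s ^+ 2) * N%:R)
  <= \sum_x expR (beta * hamiltonian J x).
Proof.
move=> beta0 s0 s1 uC cav.
apply: le_trans (variational_lb diagJ B s0 s1 beta0).
have P0 : 0 < 2 ^+ N :> R by rewrite exprn_gt0.
rewrite ler_pM2l// ler_expR mulrBl lerB// -mulrA; apply: ler_wpM2l => //.
rewrite ler_pdivlMl//.
have h x : mform J (fun=> outer B x) +
   s * (p%:R * \sum_(i | B i) `|cavity J B x i|) - 2 ^+ p * (s ^+ 2 * (C * N%:R)) <=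
   mform J (fun=> tilt_mean J B s x).
  rewrite -sum_slots_cavity; apply: mform_second_order => // u hu.
  apply: uC => j i; case: (hu j) => ->.
    by rewrite /outer /spin; case: (B i); [left|case: (x i); right; [left|right]].
  by rewrite /cavity_sign; case: (B i); [case: ifP => _; right; [left|right]|left].
apply: le_trans (ler_sum _ (fun x _ => h x)).
rewrite sumrB big_split/= sum_mform_outer add0r sum_cube_cst.
rewrite -!mulr_sumr.
have := ler_wpM2l (_ : 0 <= s * p%:R) cav; rewrite mulr_ge0// => /(_ isT).
by move: (\sum_x _) => S; lra.
Qed.

(** A lower bound on the second moment yields one on the first moment provided
    that large values carry little of the second moment: below [K] one has
    [h^2 <= K |h|], and the configurations where the part above [K] exceeds
    [delta N] are few and contribute at most [A N] each. *)
Lemma sum_abs_cavity_lb (A K c1 delta theta : R) : 0 < K ->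
  (forall x, \sum_i cavity J B x i ^+ 2 <= A * N%:R) ->
  2 ^+ N * (c1 * N%:R) <= \sum_x \sum_(i | B i) cavity J B x i ^+ 2 ->
  \sum_(x | delta * N%:R < \sum_(i | K <= `|cavity J B x i|) cavity J B x i ^+ 2) 1
    <= theta * 2 ^+ N ->
  0 <= delta -> 0 <= A ->
  2 ^+ N * ((c1 - delta - theta * A) / K * N%:R) <=
  \sum_x \sum_(i | B i) `|cavity J B x i|.
Proof.
move=> K0 hA hc hbad d0 A0.
pose bad x := delta * N%:R < \sum_(i | K <= `|cavity J B x i|) cavity J B x i ^+ 2.
have h x : \sum_(i | B i) cavity J B x i ^+ 2 <=
   K * \sum_(i | B i) `|cavity J B x i| + delta * N%:R + (bad x)%:R * (A * N%:R).
  apply: (@le_trans _ _ (K * \sum_(i | B i) `|cavity J B x i| +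
     \sum_(i | K <= `|cavity J B x i|) cavity J B x i ^+ 2)).
    rewrite mulr_sumr [leLHS]big_mkcond [X in _ <= X + _]big_mkcond.
    rewrite [X in _ <= _ + X]big_mkcond -big_split/=; apply: ler_sum => i _.
    case: (B i); last by rewrite add0r; case: ifP => _ //; exact: sqr_ge0.
    rewrite -real_normK ?num_real//; have := normr_ge0 (cavity J B x i).
    move: `|_| => t t0; case: (leP K t) => tK.
      by rewrite lerDr mulr_ge0// ltW.
    by rewrite addr0 expr2; apply: ler_wpM2r => //; exact: ltW.
  rewrite -addrA lerD2l; rewrite /bad; case: ltP => [_|h]; last by rewrite mul0r addr0.
  rewrite mul1r; apply: le_trans (_ : _ <= A * N%:R) _; last first.
    by rewrite lerDr mulr_ge0.
  apply: le_trans (hA x); rewrite big_mkcond; apply: ler_sum => i _.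
  by case: ifP => _ //; exact: sqr_ge0.
have := le_trans hc (ler_sum _ (fun x _ => h x)).
rewrite !big_split/= -mulr_sumr -!mulr_suml sum_cube_cst.
have : (\sum_x (bad x)%:R) * (A * N%:R) <= theta * 2 ^+ N * (A * N%:R).
  apply: ler_wpM2r; first by rewrite mulr_ge0.
  apply: le_trans hbad; rewrite [leRHS]big_mkcond le_eqVlt; apply/orP; left.
  by apply/eqP; apply: eq_bigr => x _; rewrite -/(bad x); case: (bad x).
set S := \sum_x \sum_(i | B i) `|_|; set D := (\sum_x _) * _ => h1 h2.
have -> : 2 ^+ N * ((c1 - delta - theta * A) / K * N%:R) =
   (2 ^+ N * ((c1 - delta - theta * A) * N%:R)) / K by field; rewrite gt_eqF.
by rewrite ler_pdivrMr//; lra.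
Qed.

End free_energy.

Section cavity_second_moment.
Context {R : realType} {q N : nat}.
Notation p := q.+2.
Variable J : p.-tuple 'I_N -> R.
Hypothesis symJ : forall t t' : p.-tuple 'I_N, perm_eq t t' -> J t = J t'.
Hypothesis diagJ : forall t : p.-tuple 'I_N, ~~ uniq t -> J t = 0.
Variable B : pred 'I_N.
Implicit Types (t : p.-tuple 'I_N) (x : {ffun 'I_N -> bool}).

(* The admissible couplings of [i]: the other indices lie outside [B]. *)
Let w i t : R := J t * ((thead t == i) && all (predC B) (behead t))%:R.

Let cavity_parity x i :
  cavity J B x i = \sum_t w i t * parity [in behead t] x.
Proof.
apply: eq_bigr => t _; rewrite /w.
have [ut|/diagJ ->] := boolP (uniq t); last by rewrite !mul0r.
rewrite prod_set_slot -!mulrA; congr (_ * _).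
have ub : uniq (behead t) by move: ut; rewrite [t]tuple_eta /= => /andP[].
have -> : \prod_(k < p | k != ord0) outer B x (tnth t k) =
          \prod_(k <- behead t) outer B x k :> R.
  rewrite (big_tuple _ _ (behead_tuple t)).
  rewrite big_mkcond big_ord_recl/= mul1r; apply: eq_bigr => k _.
  by rewrite [t in LHS]tuple_eta tnthS.
rewrite /basis -/(thead t); case: eqP => [_|]; last by rewrite !mul0r.
rewrite mul1r /=; have [/allP h|/allPn[k kt /negPn Bk]] := boolP (all _ _).
  rewrite mul1r big_uniq//; apply: eq_bigr => k kt.
  by rewrite /outer (negbTE (h k kt)).
by rewrite mul0r (big_rem k)//= /outer Bk mul0r.
Qed.

(** A cavity field is a combination of characters.  Two tuples with the same
    character and the same first index are permutations of each other, hence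
    have equal couplings: the off-diagonal terms are nonnegative and may be
    dropped. *)
Lemma sum_cavity_sqr_lb :
  2 ^+ N * \sum_(t | B (thead t) && all (predC B) (behead t)) J t ^+ 2 <=
  \sum_x \sum_(i | B i) cavity J B x i ^+ 2.
Proof.
rewrite exchange_big/=.
have h i : 2 ^+ N * \sum_t w i t ^+ 2 <= \sum_x cavity J B x i ^+ 2.
  have -> : \sum_x cavity J B x i ^+ 2 = \sum_t \sum_t' w i t * w i t' *
      \sum_x parity [in behead t] x * parity [in behead t'] x.
    transitivity (\sum_x \sum_t \sum_t' w i t * w i t' *
        (parity [in behead t] x * parity [in behead t'] x)).
      apply: eq_bigr => x _; rewrite cavity_parity expr2 mulr_suml.
      apply: eq_bigr => t _; rewrite mulr_sumr; apply: eq_bigr => t' _; ring.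
    rewrite exchange_big; apply: eq_bigr => t _; rewrite exchange_big.
    by apply: eq_bigr => t' _; rewrite mulr_sumr.
  rewrite mulr_sumr; apply: ler_sum => t _; rewrite (bigD1 t)//=.
  rewrite parity_orthogonal.
  have -> : [forall k, (k \in behead t) == (k \in behead t)].
    by apply/forallP => k.
  rewrite -expr2 [2 ^+ N * _]mulrC lerDl; apply: sumr_ge0 => t' _.
  rewrite parity_orthogonal; case: ifP => [/forallP bb|_]; last by rewrite mulr0.
  apply: mulr_ge0; last by rewrite exprn_ge0.
  have [ut|/diagJ Jt] := boolP (uniq t); last by rewrite /w Jt !mul0r.
  have [ut'|/diagJ Jt] := boolP (uniq t'); last by rewrite /w Jt !mul0r mulr0.
  rewrite /w; case: eqP => [ti|]; last by rewrite mulr0 mul0r.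
  case: eqP => [ti'|]; last by rewrite !mulr0.
  have -> : J t' = J t.
    apply: symJ; apply: uniq_perm => // k.
    rewrite [t]tuple_eta [t']tuple_eta /= !inE ti ti'.
    by rewrite (eqP (bb k)).
  have -> (a b c : R) : a * b * (a * c) = a ^+ 2 * (b * c) by ring.
  by rewrite mulr_ge0 ?sqr_ge0// mulr_ge0 ?ler0n.
apply: le_trans (ler_sum _ (fun i _ => h i)).
rewrite -mulr_sumr ler_pM2l ?exprn_gt0// exchange_big/=.
rewrite big_mkcond; apply: ler_sum => t _.
case: ifP => [/andP[Bt at']|_]; last by apply: sumr_ge0 => i _; exact: sqr_ge0.
rewrite (bigD1 (thead t))//= /w eqxx at' mulr1 lerDl.
by apply: sumr_ge0 => i _; exact: sqr_ge0.
Qed.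

End cavity_second_moment.

(** * Expectations of independent and Gaussian variables *)

Section density_transfer.
Local Open Scope ereal_scope.
Context {R : realType} {d : measure_display} {T : measurableType d}.
Variables (mu : {measure set T -> \bar R}) (nu : {measure set R -> \bar R}).
Import HBNNSimple.

(** If the measure with density [F] has image [c nu] under [X], then integrals of
    [f o X] against it are [c] times integrals against [nu].  Used with [nu] the
    law of a variable independent of [F], and with [F] the normal density. *)
Lemma integral_density_transfer (F : T -> R) (X : T -> R) (c : \bar R)
    (f : R -> R) :
  measurable_fun setT F -> (forall w, (0 <= F w)%R) ->
  measurable_fun setT X ->
  measurable_fun setT f -> (forall x, (0 <= f x)%R) ->
  c \is a fin_num ->
  (forall B, measurable B -> \int[mu]_w (F w * \1_B (X w))%:E = c * nu B) ->
  \int[mu]_w (F w * f (X w))%:E = c * \int[nu]_x (f x)%:E.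
Proof.
move=> mF F0 mX mf f0 cfin H.
have mfE : @measurable_fun _ _ R (\bar R) setT (EFin \o f).
  exact/measurable_EFinP.
pose h := nnsfun_approx measurableT mfE.
have hcvg x : (h n x)%:E @[n --> \oo] --> (f x)%:E.
  by apply: cvg_nnsfun_approx => // y _ /=; rewrite lee_fin.
have hnd x : {homo (fun n => (h n x)%:E) : m n / (m <= n)%N >-> m <= n}.
  by move=> m n mn; rewrite lee_fin; exact/lefP/nd_nnsfun_approx.
have mh n : measurable_fun setT (fun w => h n (X w)).
  by apply: (measurableT_comp (measurable_funP _) mX).
have -> : \int[nu]_x (f x)%:E = limn (fun n => \int[nu]_x (h n x)%:E).
  rewrite -monotone_convergence//.
  - by apply: eq_integral => w _; apply/esym/cvg_lim.
  - by move=> n; apply/measurable_EFinP; exact: measurable_funP.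
  - by move=> n w _; rewrite lee_fin.
have -> : \int[mu]_w (F w * f (X w))%:E =
          limn (fun n => \int[mu]_w (F w * h n (X w))%:E).
  rewrite -monotone_convergence//.
  - apply: eq_integral => w _; apply/esym/cvg_lim => //.
    under eq_fun do rewrite EFinM.
    by rewrite EFinM; apply: cvgeZl.
  - by move=> n; apply/measurable_EFinP; exact: measurable_funM.
  - by move=> n w _; rewrite lee_fin mulr_ge0.
  - move=> w _ m n mn; rewrite !EFinM; apply: lee_wpmul2l.
      by rewrite lee_fin.
    exact: hnd.
have step n : \int[mu]_w (F w * h n (X w))%:E = c * \int[nu]_x (h n x)%:E.
  have mB k : measurable (h n @^-1` [set k]) by [].
  have mi k : measurable_fun setT (\1_(h n @^-1` [set k]) : R -> R) by [].
  have m1 k : measurable_fun setT (fun w => \1_(h n @^-1` [set k]) (X w) : R).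
    exact: (measurableT_comp _ mX).
  have k0 k x : (0 <= k * \1_(h n @^-1` [set k]) x)%R.
    by rewrite -lee_fin EFinM nnfun_muleindic_ge0.
  have -> : \int[mu]_w (F w * h n (X w))%:E = \sum_(k \in range (h n))
      \int[mu]_w (F w * (k * \1_(h n @^-1` [set k]) (X w)))%:E.
    rewrite -ge0_integral_fsum//.
    - apply: eq_integral => w _; rewrite (fimfunE (h n)) EFinM -fsumEFin//.
      by rewrite ge0_mule_fsumr// => k; rewrite lee_fin.
    - move=> k; apply/measurable_EFinP; apply: measurable_funM => //.
      exact: measurable_funM.
    - by move=> k w _; rewrite lee_fin mulr_ge0.
  have -> : \int[nu]_x (h n x)%:E = \sum_(k \in range (h n))
      \int[nu]_x (k * \1_(h n @^-1` [set k]) x)%:E.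
    rewrite -ge0_integral_fsum//.
    - by apply: eq_integral => w _; rewrite (fimfunE (h n)) -fsumEFin.
    - by move=> k; apply/measurable_EFinP; exact: measurable_funM.
    - by move=> k w _; rewrite lee_fin.
  rewrite ge0_mule_fsumr//; last first.
    by move=> k; apply: integral_ge0 => w _; rewrite lee_fin.
  apply: eq_fsbigr => k; rewrite inE => -[x _ hk].
  have kge0 : (0 <= k)%R by rewrite -hk.
  under eq_integral do rewrite mulrCA EFinM.
  rewrite ge0_integralZl//; last 2 first.
    by apply/measurable_EFinP; exact: measurable_funM.
    by move=> w _; rewrite lee_fin mulr_ge0// indicE ler0n.
  under [X in _ = _ * X]eq_integral do rewrite EFinM.
  rewrite [X in _ = _ * X]ge0_integralZl//; last first.
    by apply/measurable_EFinP.
  by rewrite H// integral_indic// setIT muleCA.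
under eq_fun do rewrite step.
apply/cvg_lim => //.
have cv : cvgn (fun n => \int[nu]_x (h n x)%:E).
  apply: ereal_nondecreasing_is_cvgn => m n mn; apply: ge0_le_integral => //.
  - by move=> w _; rewrite lee_fin.
  - by apply/measurable_EFinP; exact: measurable_funP.
  - by apply/measurable_EFinP; exact: measurable_funP.
  - by move=> w _; exact: hnd.
by apply: cvgeZl.
Qed.

End density_transfer.

Section independent_products.
Local Open Scope ereal_scope.
Context {R : realType} {d : measure_display} {T : measurableType d}.
Variables (P : probability T R) (I : eqType) (X : I -> {RV P >-> R}).
Hypothesis indX : mutually_independent X.

(* Independence is given for events; one indicator at a time is replaced by
   a function, the remaining factors serving as a density. *)
Let integral_prod_indic (f : I -> R -> R) (s1 s2 : seq I) (B : I -> set R) :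
  (forall i, measurable_fun setT (f i)) -> (forall i x, (0 <= f i x)%R) ->
  (forall i, \int[P]_w (f i (X i w))%:E \is a fin_num) ->
  uniq (s1 ++ s2) -> (forall i, measurable (B i)) ->
  \int[P]_w ((\prod_(i <- s1) f i (X i w)) * \prod_(i <- s2) \1_(B i) (X i w))%:E
  = \prod_(i <- s1) \int[P]_w (f i (X i w))%:E *
    \prod_(i <- s2) P (X i @^-1` B i).
Proof.
move=> mf f0 ffin.
elim: s1 s2 B => [|t s1 IH] s2 B.
  rewrite cat0s => us mB; rewrite big_nil mul1e.
  under eq_integral do rewrite big_nil mul1r.
  rewrite -(indX us) => [|i _]; last exact: mB.
  rewrite -[in RHS](setIT (\bigcap_(i in _) _)) -integral_indic//; last first.
    apply: fin_bigcap_measurable => [|i _]; first exact: finite_seq.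
    rewrite -[X in measurable X]setTI; exact: measurable_funP.
  apply: eq_integral => w _; congr EFin.
  rewrite -[LHS]/(\prod_(i <- s2) \1_(X i @^-1` B i) w)%R.
  elim: s2 {us} => [|j s2 IHs].
    rewrite big_nil (_ : [set` _] = set0) ?bigcap_set0 ?indicT//.
    by apply/seteqP; split => x.
  rewrite big_cons IHs (_ : [set` j :: s2] = j |` [set` s2]); last first.
    apply/seteqP; split => x /=; rewrite inE.
      by move=> /predU1P[]; [left|right].
    by move=> [->|->]; rewrite ?eqxx ?orbT.
  by rewrite bigcap_setU1 indicI.
rewrite cat_cons /= => /andP[tns us] mB.
pose F w := ((\prod_(i <- s1) f i (X i w)) * \prod_(i <- s2) \1_(B i) (X i w))%R.
have mX i : measurable_fun setT (X i) by exact: measurable_funP.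
have mF : measurable_fun setT F.
  apply: measurable_funM.
    apply: (@measurable_prod _ _ _ _ _ s1 (fun i w => f i (X i w))) => i _.
    exact: (measurableT_comp (mf i) (mX i)).
  apply: (@measurable_prod _ _ _ _ _ s2 (fun i w => \1_(B i) (X i w))) => i _.
  by apply: (measurableT_comp _ (mX i)); exact: measurable_indic.
have F0 w : (0 <= F w)%R.
  by apply: mulr_ge0; apply: prodr_ge0 => i _.
have := IH s2 B us mB; rewrite -/F => EF.
have Ffin : \int[P]_w (F w)%:E \is a fin_num.
  have bigfin (s : seq I) (a : I -> \bar R) : (forall i, a i \is a fin_num) ->
      \prod_(i <- s) a i \is a fin_num.
    by move=> afin; elim/big_ind: _ => // x y; exact: fin_numM.
  rewrite EF; apply: fin_numM; apply: bigfin => // i.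
  by apply: fin_num_measure; rewrite -[X in measurable X]setTI; exact: mX.
rewrite [in RHS]big_cons.
transitivity (\int[P]_w (F w * f t (X t w))%:E).
  by apply: eq_integral => w _; rewrite big_cons /F; congr EFin; ring.
rewrite (@integral_density_transfer _ _ _ P (distribution P (X t)) F (X t)
  (\int[P]_w (F w)%:E) (f t))//.
  rewrite ge0_integral_distribution//.
  - by rewrite EF muleC muleA.
  - by apply/measurable_EFinP.
  - by move=> x; rewrite lee_fin.
move=> B' mB'.
have us' : uniq (s1 ++ t :: s2).
  by rewrite -(cat1s t) uniq_catCA /= tns.
pose B2 i := if i == t then B' else B i.
have mB2 i : measurable (B2 i) by rewrite /B2; case: ifP.
have ts2 : t \notin s2 by move: tns; rewrite mem_cat negb_or => /andP[].
have B2E i : i \in s2 -> B2 i = B i.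
  by move=> is2; rewrite /B2; case: eqP is2 ts2 => // -> ->.
have B2t : B2 t = B' by rewrite /B2 eqxx.
have := IH _ _ us' mB2; rewrite [in RHS]big_cons B2t.
have -> : \prod_(i <- s2) P (X i @^-1` B2 i) = \prod_(i <- s2) P (X i @^-1` B i).
  by apply: eq_big_seq => i is2; rewrite B2E.
rewrite muleCA muleC -EF => <-; apply: eq_integral => w _; congr EFin.
rewrite big_cons B2t /F -mulrA; congr (_ * _)%R; rewrite mulrC; congr (_ * _)%R.
by apply: eq_big_seq => i is2; rewrite B2E.
Qed.

Lemma integral_prod_indep (f : I -> R -> R) (s : seq I) :
  (forall i, measurable_fun setT (f i)) -> (forall i x, (0 <= f i x)%R) ->
  (forall i, \int[P]_w (f i (X i w))%:E \is a fin_num) -> uniq s ->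
  \int[P]_w (\prod_(i <- s) f i (X i w))%:E =
  \prod_(i <- s) \int[P]_w (f i (X i w))%:E.
Proof.
move=> mf f0 ffin us; rewrite -[RHS]mule1.
have := @integral_prod_indic f s [::] (fun=> set0) mf f0 ffin.
rewrite cats0 !big_nil => <- //.
by apply: eq_integral => w _; rewrite big_nil mulr1.
Qed.

End independent_products.

Section gaussian_integrals.
Local Open Scope ereal_scope.
Context {R : realType} {d : measure_display} {T : measurableType d}.
Variables (P : probability T R) (X : {RV P >-> R}).
Hypothesis gX : standard_gaussian X.
Notation leb := (@lebesgue_measure R).

Lemma integral_gaussian (f : R -> R) :
  measurable_fun setT f -> (forall x, (0 <= f x)%R) ->
  \int[P]_w (f (X w))%:E = \int[leb]_x (normal_pdf 0 1 x * f x)%:E.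
Proof.
move=> mf f0.
rewrite -(@ge0_integral_distribution _ _ _ _ _ P X (EFin \o f)); last 2 first.
  by apply/measurable_EFinP.
  by move=> x; rewrite lee_fin.
have := @integral_density_transfer _ _ _ leb (distribution P X)
  (normal_pdf 0 1) id 1 f.
rewrite mul1e => -> //.
- exact: measurable_normal_pdf.
- by move=> x; exact: normal_pdf_ge0.
move=> B mB; rewrite mul1e; transitivity (normal_prob 0 1 B); last by rewrite -(gX mB).
rewrite /normal_prob [RHS]integral_mkcond.
apply: eq_integral => x _; rewrite patchE indicE; case: ifPn => _.
  by rewrite mulr1.
by rewrite mulr0.
Qed.

(** Completing the square turns [e^(c x)] times the standard density into
    [e^(c^2 / 2)] times the density of mean [c]. *)
Lemma gaussian_mgf (c : R) :
  \int[P]_w (expR (c * X w))%:E = (expR (c ^+ 2 / 2))%:E.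
Proof.
have mf : measurable_fun [set: R] (fun x : R => expR (c * x)).
  by apply: measurableT_comp => //; exact: measurable_funM.
rewrite (@integral_gaussian (fun x => expR (c * x)))//.
have E x : (normal_pdf 0 1 x * expR (c * x))%:E =
           (expR (c ^+ 2 / 2))%:E * (normal_pdf c 1 x)%:E.
  rewrite -EFinM !normal_pdfE ?oner_neq0// /normal_fun; congr EFin.
  rewrite -mulrA -expRD [RHS]mulrCA -expRD; congr (_ * expR _)%R.
  by field.
under eq_integral do rewrite E.
rewrite ge0_integralZl//.
- by rewrite integral_normal_pdf mule1.
- by apply/measurable_EFinP; exact: measurable_normal_pdf.
- by move=> x _; rewrite lee_fin normal_pdf_ge0.
Qed.

(** [e^(-x^2)] times the standard density is a multiple of the normal density of
    variance 1/3. *)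
Lemma gaussian_expN_sq :
  \int[P]_w (expR (- (X w) ^+ 2))%:E = ((Num.sqrt 3)^-1)%:E.
Proof.
have mf : measurable_fun [set: R] (fun x : R => expR (- x ^+ 2)).
  by apply: measurableT_comp => //; apply: measurableT_comp => //.
rewrite (@integral_gaussian (fun x => expR (- x ^+ 2)))//.
set s := ((Num.sqrt 3)^-1)%R.
have s0 : (0 < s)%R by rewrite invr_gt0 sqrtr_gt0.
have s2 : (s ^+ 2 = 3^-1)%R by rewrite exprVn sqr_sqrtr.
have E x : (normal_pdf 0 1 x * expR (- x ^+ 2))%:E =
           s%:E * (normal_pdf 0 s x)%:E.
  rewrite -EFinM !normal_pdfE ?oner_neq0 ?gt_eqF// /normal_fun.
  congr EFin; rewrite -mulrA -expRD mulrA; congr (_ * expR _)%R; last first.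
    by rewrite s2 expr1n; field.
  rewrite /normal_peak s2 expr1n mul1r -(mulrnAr 3^-1)%R.
  rewrite [in RHS]sqrtrM// sqrtrV// invfM invrK mulrA mulVf ?mul1r//.
under eq_integral do rewrite E.
rewrite ge0_integralZl//.
- by rewrite integral_normal_pdf mule1.
- by apply/measurable_EFinP; exact: measurable_normal_pdf.
- by move=> x _; rewrite lee_fin normal_pdf_ge0.
- by rewrite lee_fin ltW.
Qed.

End gaussian_integrals.

(** * Gaussian multilinear forms *)

Section sk_tensor_facts.
Context {R : realType} {p N : nat}.
Variable g : incr_tuple p -> R.
Implicit Types t : p.-tuple 'I_N.

(** The index set of [t] as an increasing tuple, if its indices are distinct. *)
Definition sk_key t : option (incr_tuple p) :=
  insub (sort_tuple leq (map_tuple val t)).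

Lemma sk_key_perm t t' : perm_eq t t' -> sk_key t = sk_key t'.
Proof.
move=> tt'; congr insub; apply: val_inj => /=.
by apply/(perm_sortP leq_total leq_trans anti_leq)/perm_map.
Qed.

Lemma sk_tensorE t : sk_tensor g t =
  if sk_key t is Some s then N%:R `^ ((1 - p%:R) / 2) * g s else 0.
Proof. by []. Qed.

Lemma sk_tensor_sym t t' : perm_eq t t' -> sk_tensor g t = sk_tensor g t'.
Proof. by move=> /sk_key_perm E; rewrite !sk_tensorE E. Qed.

Lemma sk_key_perm_val t s : sk_key t = Some s -> perm_eq (map val t) (val (val s)).
Proof.
rewrite /sk_key; case: insubP => // s' _ vs' [<-].
by rewrite vs' /= perm_sym perm_sort.
Qed.

Lemma sk_tensor_diag t : ~~ uniq t -> sk_tensor g t = 0.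
Proof.
move=> nut; rewrite sk_tensorE; case E: (sk_key t) => [s|//].
have us : uniq (val (val s)).
  by apply: sorted_uniq (valP s); [exact: ltn_trans|exact: ltnn].
move: nut; rewrite -(map_inj_uniq (@val_inj _ _ 'I_N)).
by rewrite (perm_uniq (sk_key_perm_val E)) us.
Qed.

Lemma sk_key_incr t (s : incr_tuple p) :
  perm_eq (map val t) (val (val s)) -> sk_key t = Some s.
Proof.
move=> h; rewrite /sk_key.
have E : sort_tuple leq (map_tuple val t) = val s.
  apply: val_inj => /=; rewrite (perm_sortP leq_total leq_trans anti_leq _ _ h).
  apply: sorted_sort; first exact: leq_trans.
  apply: sub_sorted (valP s) => a b; exact: ltnW.
by rewrite E valK.
Qed.

Lemma card_sk_key s : (#|[pred t | sk_key t == Some s]| <= p`!)%N.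
Proof.
have us : uniq (val (val s)).
  by apply: sorted_uniq (valP s); [exact: ltn_trans|exact: ltnn].
have <- : size (permutations (val (val s))) = p`!.
  by rewrite size_permutations// size_tuple.
rewrite cardE -(size_map (fun t : p.-tuple 'I_N => map val t)).
apply: uniq_leq_size.
  rewrite map_inj_uniq ?enum_uniq// => t t' /(inj_map val_inj) tt'.
  exact: val_inj.
move=> u /mapP[t]; rewrite mem_enum => /eqP kt ->.
by rewrite mem_permutations sk_key_perm_val.
Qed.

End sk_tensor_facts.

Lemma sqr_sum_le_card {R : realType} {T : finType} (A : pred T) (F : T -> R) :
  (\sum_(t | A t) F t) ^+ 2 <= #|[pred t | A t]|%:R * \sum_(t | A t) F t ^+ 2.
Proof.
rewrite expr2 mulr_suml.
apply: (@le_trans _ _ (\sum_(t | A t) \sum_(t' | A t') (F t ^+ 2 + F t' ^+ 2) / 2)).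
  apply: ler_sum => t _; rewrite mulr_sumr; apply: ler_sum => t' _.
  by have := sqr_ge0 (F t - F t'); rewrite !expr2; lra.
have E : \sum_(t | A t) \sum_(t' | A t') (F t ^+ 2 + F t' ^+ 2) / 2 =
    \sum_(t | A t) (#|[pred t | A t]|%:R * F t ^+ 2 / 2
                    + (\sum_(t' | A t') F t' ^+ 2) / 2).
  apply: eq_bigr => t _; rewrite -mulr_suml big_split/= mulrDl; congr (_ / 2 + _).
  by rewrite sumr_const -(mulr_natl (F t ^+ 2)).
rewrite E big_split/= -!mulr_suml -mulr_sumr sumr_const.
by rewrite -(mulr_natl (\sum_(t | A t) F t ^+ 2)); lra.
Qed.

Lemma sum_tuple_prod {R : realType} {p N : nat} (F : 'I_p -> 'I_N -> R) :
  \sum_(t : p.-tuple 'I_N) \prod_(j < p) F j (tnth t j) =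
  \prod_(j < p) \sum_(i < N) F j i.
Proof.
rewrite bigA_distr_bigA (reindex (fun t : p.-tuple 'I_N => [ffun j => tnth t j]))/=.
  by apply: eq_bigr => t _; apply: eq_bigr => j _; rewrite ffunE.
exists (fun f : {ffun 'I_p -> 'I_N} => [tuple f j | j < p]) => [t|f] _.
  by apply: eq_from_tnth => j; rewrite tnth_mktuple ffunE.
by apply/ffunP => j; rewrite ffunE tnth_mktuple.
Qed.

(** The normalization compensates [p - 1] slots of squared length [N]. *)
Lemma sk_scale_sqr {R : realType} (q N : nat) : (0 < N)%N ->
  (N%:R `^ ((1 - q.+2%:R) / 2)) ^+ 2 * N%:R ^+ q.+1 = 1 :> R.
Proof.
move=> N0.
rewrite -powR_mulrn ?powR_ge0// -powRrM divfK// -powR_mulrn// -powRD; last first.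
  by rewrite pnatr_eq0 -lt0n N0 implybT.
by rewrite (_ : _ + _ = 0) ?powRr0// -(natr1 q.+1); ring.
Qed.

Section gaussian_form.
Context {R : realType} {d : measure_display} {Omega : measurableType d}.
Variables (P : probability Omega R) (q : nat).
Notation p := q.+2.
Variable g : incr_tuple p -> {RV P >-> R}.
Hypothesis hind : mutually_independent g.
Hypothesis hgauss : forall t, standard_gaussian (g t).

Definition sk (w : Omega) N : p.-tuple 'I_N -> R :=
  @sk_tensor R p (fun t => g t w) N.

(* The couplings that occur in a form of size [N]. *)
Let keys N : seq (incr_tuple p) :=
  undup (pmap (@sk_key p N) (enum {: p.-tuple 'I_N})).

Let coef N (z : 'I_p -> 'I_N -> R) (s : incr_tuple p) : R :=
  N%:R `^ ((1 - p%:R) / 2) *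
  \sum_(t | sk_key t == Some s) \prod_(j < p) z j (tnth t j).

Let mformE N (z : 'I_p -> 'I_N -> R) w :
  mform (@sk w N) z = \sum_(s <- keys N) coef z s * g s w.
Proof.
under [RHS]eq_bigr => s _ do rewrite /coef mulrAC mulr_sumr big_mkcond.
rewrite exchange_big /mform; apply: eq_bigr => t _ /=.
rewrite /sk sk_tensorE; case E: (sk_key t) => [s|]; last first.
  by rewrite mul0r big1.
have us : s \in keys N.
  rewrite mem_undup mem_pmap; apply/mapP; exists t; first by rewrite mem_enum.
  by rewrite E.
rewrite (bigD1_seq s)//= ?undup_uniq// eqxx [X in _ = _ + X]big1 ?addr0// => s' s's.
by case: eqP => // -[ss']; rewrite ss' eqxx in s's.
Qed.

Let sum_coef N (z : 'I_p -> 'I_N -> R) : (0 < N)%N ->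
  (\prod_(j < p | j != ord0) \sum_i z j i ^+ 2 <= N%:R ^+ q.+1) ->
  \sum_(s <- keys N) coef z s ^+ 2 <= (p`!)%:R * \sum_i z ord0 i ^+ 2.
Proof.
move=> N0 zN.
pose b (t : p.-tuple 'I_N) := \prod_(j < p) z j (tnth t j).
have h : \sum_(s <- keys N) \sum_(t | sk_key t == Some s) b t ^+ 2 <=
         \sum_i z ord0 i ^+ 2 * N%:R ^+ q.+1.
  apply: (@le_trans _ _ (\sum_(t : p.-tuple 'I_N) b t ^+ 2)).
    under eq_bigr do rewrite big_mkcond.
    rewrite exchange_big; apply: ler_sum => t _ /=.
    case E: (sk_key t) => [s|]; last by rewrite big1 ?sqr_ge0.
    have us : s \in keys N.
      rewrite mem_undup mem_pmap; apply/mapP; exists t; first by rewrite mem_enum.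
      by rewrite E.
    rewrite (bigD1_seq s)//= ?undup_uniq// eqxx [X in _ + X <= _]big1 ?addr0// => s' s's.
    by case: eqP => // -[ss']; rewrite ss' eqxx in s's.
  rewrite /b; under eq_bigr do rewrite -prodrXl.
  rewrite (sum_tuple_prod (fun j i => z j i ^+ 2)) (bigD1 ord0)//= -mulr_suml.
  by apply: ler_wpM2l => //; apply: sumr_ge0 => i _; exact: sqr_ge0.
have a2 := sk_scale_sqr (R := R) q N0.
apply: (@le_trans _ _ (\sum_(s <- keys N) (N%:R `^ ((1 - p%:R) / 2)) ^+ 2 *
   ((p`!)%:R * \sum_(t | sk_key t == Some s) b t ^+ 2))).
  apply: ler_sum => s _; rewrite /coef exprMn; apply: ler_wpM2l; first exact: sqr_ge0.
  apply: le_trans (sqr_sum_le_card _ _) _; apply: ler_wpM2r.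
    by apply: sumr_ge0 => t _; exact: sqr_ge0.
  by rewrite ler_nat card_sk_key.
rewrite -mulr_sumr -mulr_sumr mulrCA; apply: ler_wpM2l; first exact: ler0n.
apply: le_trans (ler_wpM2l (sqr_ge0 _) h) _.
by rewrite -mulr_suml mulrCA a2 mulr1.
Qed.

Lemma measurable_mform N (z : 'I_p -> 'I_N -> R) :
  measurable_fun setT (fun w => mform (@sk w N) z).
Proof.
under eq_fun do rewrite mformE.
apply: measurable_sum => s; apply: measurable_funM => //.
Qed.

(** The form is linear in the independent variables [g].  A coupling collects the
    at most [p!] orderings of its index set, so by Cauchy-Schwarz the sum of its
    squared coefficients is at most [p!] times the product of the squared
    lengths of the slots, up to the normalization. *)
Lemma mform_mgf N (z : 'I_p -> 'I_N -> R) (l : R) : (0 < N)%N ->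
  (\prod_(j < p | j != ord0) \sum_i z j i ^+ 2 <= N%:R ^+ q.+1) ->
  (\int[P]_w (expR (l * mform (@sk w N) z))%:E <=
   (expR (l ^+ 2 * ((p`!)%:R * \sum_i z ord0 i ^+ 2) / 2))%:E)%E.
Proof.
move=> N0 zN.
have E w : expR (l * mform (@sk w N) z) =
    \prod_(s <- keys N) expR (l * coef z s * g s w).
  by rewrite mformE mulr_sumr expR_sum; apply: eq_bigr => s _; rewrite mulrA.
under eq_integral do rewrite E.
rewrite (integral_prod_indep hind (f := fun s x => expR (l * coef z s * x)))//.
- under eq_bigr do rewrite gaussian_mgf//.
  rewrite prodEFin -expR_sum lee_fin ler_expR -mulr_suml.
  apply: ler_wpM2r => //; under eq_bigr do rewrite exprMn.
  by rewrite -mulr_sumr; apply: ler_wpM2l; [exact: sqr_ge0|exact: sum_coef].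
- by move=> s; apply: measurableT_comp => //; exact: measurable_funM.
- by move=> s; rewrite gaussian_mgf.
- exact: undup_uniq.
Qed.

End gaussian_form.

(** * Uniform tail bounds from lattice sums *)

Lemma sum_option {V : nmodType} {T : finType} (F : option T -> V) :
  \sum_o F o = F None + \sum_t F (Some t).
Proof.
rewrite (bigD1 None)//=; congr (_ + _).
rewrite (reindex_omap Some id); last by case.
by apply: eq_bigl => t; rewrite eqxx.
Qed.

Section lattice_sum.
Context {R : realType} (N K : nat) (delta : R).
Hypotheses (K0 : (0 < K)%N) (delta0 : 0 <= delta).
Implicit Types w : 'I_N -> R.

(** A bound on the integers used below, which keeps the sum finite: one
    coordinate that reaches it already has a square above [delta N / 4]. *)
Definition cap : nat := (Num.truncn (delta * N%:R / 4)).+1.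

Notation site := (option ('I_cap.+1 * bool)).

(** Zero or an integer of absolute value at least [K].  Zero has a single
    representative, so that the sum over one site is close to 1 when [K] is large. *)
Definition site_val (o : site) : R :=
  if o is Some (m, b) then (if b then 1 else -1) * (K + m)%:R else 0.

Implicit Types k : {ffun 'I_N -> site}.

(** An upper bound for the indicator of the event that some integer vector [k]
    satisfies [<k, w> >= |k|^2 >= delta N / 4]. *)
Definition lattice_fun (mu nu : R) w : R :=
  \sum_(k : {ffun 'I_N -> site}) expR (mu * (\sum_i site_val (k i) * w i - \sum_i site_val (k i) ^+ 2)
             + nu * (\sum_i site_val (k i) ^+ 2 - delta * N%:R / 4)).

Let cap_sqr : delta * N%:R / 4 <= (K + cap)%:R ^+ 2.
Proof.
have h : delta * N%:R / 4 < cap%:R by exact: truncnS_gt.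
apply: (le_trans (ltW h)); rewrite -natrX ler_nat.
by apply: (@leq_trans (K + cap)); rewrite ?leq_addl// -mulnn leq_pmulr// addn_gt0 K0.
Qed.

(* The integer is [x] rounded towards zero and truncated at [K + cap]; rounding
   loses at most a factor 2 as [|x| >= 1]. *)
Let site_approx (x : R) : exists o : site, site_val o ^+ 2 <= site_val o * x /\
  (K%:R <= `|x| -> x ^+ 2 / 4 <= site_val o ^+ 2 \/
                   delta * N%:R / 4 <= site_val o ^+ 2).
Proof.
have [Kx|xK] := leP K%:R `|x|; last first.
  by exists None; rewrite /site_val expr0n mul0r; split.
pose n := Num.truncn `|x|.
have nx : n%:R <= `|x| by rewrite truncn_le.
have xn : `|x| < n.+1%:R by exact: truncnS_gt.
have Kn : (K <= n)%N by rewrite -ltnS -(ltr_nat R); exact: le_lt_trans xn.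
have sgx (m : nat) : m%:R <= `|x| ->
    ((if 0 <= x then 1 else -1) * m%:R) ^+ 2 <= (if 0 <= x then 1 else -1) * m%:R * x.
  move=> mx; have -> : (if 0 <= x then 1 else -1) * m%:R * x = m%:R * `|x|.
    by have [x0|x0] := leP 0 x; rewrite ?(ger0_norm x0) ?(ltr0_norm x0); ring.
  rewrite exprMn (_ : (if 0 <= x then 1 else -1) ^+ 2 = 1); last by case: ifP => _; ring.
  by rewrite mul1r expr2; apply: ler_wpM2l.
have [nc|cn] := leqP (n - K) cap.
  have nc' : (n - K < cap.+1)%N by [].
  exists (Some (Ordinal nc', 0 <= x)); rewrite /site_val /= subnKC//.
  split; first exact: sgx.
  move=> _; left; rewrite exprMn (_ : (if 0 <= x then 1 else -1) ^+ 2 = 1); last first.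
    by case: ifP => _; ring.
  have n1 : 1 <= n%:R :> R by rewrite ler1n (leq_trans K0).
  rewrite mul1r -[x ^+ 2]real_normK ?num_real//.
  move: xn; rewrite -natr1; have := normr_ge0 x; move: `|x| => t t0 tn.
  by rewrite !expr2; nra.
have cc : (cap < cap.+1)%N by [].
exists (Some (Ordinal cc, 0 <= x)); rewrite /site_val /=; split.
  apply: sgx; apply: le_trans nx; rewrite ler_nat.
  by rewrite -leq_subRL// ltnW.
move=> _; right; rewrite exprMn (_ : (if 0 <= x then 1 else -1) ^+ 2 = 1).
  by rewrite mul1r.
by case: ifP => _; ring.
Qed.

Lemma lattice_fun_ge0 mu nu w : 0 <= lattice_fun mu nu w.
Proof. by apply: sumr_ge0 => k _; exact: expR_ge0. Qed.

Lemma lattice_fun_ge1 mu nu w : 0 <= mu -> 0 <= nu ->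
  delta * N%:R < \sum_(i | K%:R <= `|w i|) w i ^+ 2 ->
  1 <= lattice_fun mu nu w.
Proof.
move=> mu0 nu0 big.
pose k : {ffun 'I_N -> site} := [ffun i => projT1 (cid (site_approx (w i)))].
have kP i : site_val (k i) ^+ 2 <= site_val (k i) * w i /\
  (K%:R <= `|w i| -> w i ^+ 2 / 4 <= site_val (k i) ^+ 2 \/
                   delta * N%:R / 4 <= site_val (k i) ^+ 2).
  by rewrite ffunE; case: (cid _).
rewrite /lattice_fun (bigD1 k)//=.
apply: (@le_trans _ _ (expR 0)); first by rewrite expR0.
rewrite -[leLHS]addr0; apply: lerD; last first.
  by apply: sumr_ge0 => ? _; exact: expR_ge0.
rewrite ler_expR addr_ge0// mulr_ge0// subr_ge0.
  by apply: ler_sum => i _; case: (kP i).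
have [[i Ki]|nex] := pselect (exists i, delta * N%:R / 4 <= site_val (k i) ^+ 2).
  apply: (le_trans Ki); rewrite (bigD1 i)//= lerDl.
  by apply: sumr_ge0 => j _; exact: sqr_ge0.
apply: (@le_trans _ _ (\sum_(i | K%:R <= `|w i|) w i ^+ 2 / 4)).
  by rewrite -mulr_suml ler_pM2r// ltW.
rewrite big_mkcond; apply: ler_sum => i _; case: ifP => [Kw|_]; last exact: sqr_ge0.
have [_ /(_ Kw)[//|h]] := kP i.
by case: nex; exists i.
Qed.

(** The sum factorizes over the sites, and each factor is a geometric series. *)
Lemma sum_lattice_gaussian (a : R) : 0 < a ->
  \sum_(k : {ffun 'I_N -> site}) expR (- (a * \sum_i site_val (k i) ^+ 2)) <=
  expR (2 * expR (- (a * K%:R)) / (1 - expR (- a)) * N%:R).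
Proof.
move=> a0.
have r1 : expR (- a) < 1 by rewrite expR_lt1 oppr_lt0.
have d0 : 0 < 1 - expR (- a) by rewrite subr_gt0.
have -> : \sum_(k : {ffun 'I_N -> site}) expR (- (a * \sum_i site_val (k i) ^+ 2)) =
    \sum_(k : {ffun 'I_N -> site}) \prod_i expR (- (a * site_val (k i) ^+ 2)).
  by apply: eq_bigr => k _; rewrite mulr_sumr -sumrN expR_sum.
rewrite -(bigA_distr_bigA (fun (i : 'I_N) (o : site) => expR (- (a * site_val o ^+ 2)))).
rewrite prodr_const card_ord mulrC expRM_natl; apply: lerXn2r.
- by rewrite nnegrE; apply: sumr_ge0 => o _; exact: expR_ge0.
- by rewrite nnegrE; exact: expR_ge0.
rewrite sum_option /= expr0n mulr0 oppr0 expR0.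
apply: le_trans (expR_ge1Dx _); rewrite lerD2l.
rewrite (_ : \sum_t _ = \sum_(m < cap.+1) \sum_(b : bool)
    expR (- (a * ((if b then 1 else -1) * (K + m)%:R) ^+ 2))); last first.
  by rewrite pair_big; apply: eq_bigr => -[].
rewrite ler_pdivlMr//.
apply: (@le_trans _ _ ((\sum_(m < cap.+1) 2 * expR (- (a * K%:R)) * expR (- a) ^+ m) *
   (1 - expR (- a)))).
  apply: ler_wpM2r; first exact: ltW.
  apply: ler_sum => m _; rewrite big_bool /= mul1r mulN1r sqrrN -mulrA.
  suff : expR (- (a * (K + m)%:R ^+ 2)) <= expR (- (a * K%:R)) * expR (- a) ^+ m.
    by move=> h; lra.
  rewrite -expRM_natl -expRD ler_expR mulrN -opprD lerN2 [m%:R * a]mulrC -mulrDr.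
  by rewrite ler_pM2l// -natrD -natrX ler_nat -mulnn leq_pmulr// addn_gt0 K0.
rewrite -mulr_sumr -mulrA ler_piMr ?mulr_ge0 ?expR_ge0//.
by rewrite mulrC -opprB mulNr -subrX1 opprB gerBl exprn_ge0 ?expR_ge0.
Qed.

End lattice_sum.

Section almost_sure.
Context {R : realType} {d : measure_display} {T : measurableType d}.
Variable P : probability T R.

Lemma geometric_partial_le (r : R) n : 0 <= r -> r < 1 ->
  \sum_(i < n) r ^+ i <= (1 - r)^-1.
Proof.
move=> r0 r1; have d0 : 0 < 1 - r by rewrite subr_gt0.
rewrite -[_^-1]mul1r ler_pdivlMr//.
by rewrite mulrC -opprB mulNr -subrX1 opprB gerBl exprn_ge0.
Qed.

(** The expectation of [sum_N Y_N] is finite, so the series converges almost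
    surely and its terms tend to zero.  This replaces a Borel-Cantelli argument
    and spares the measurability of the events bounded by [Y_N]. *)
Lemma ae_cvg0_of_summable (Y : nat -> T -> R) (c r : R) :
  (forall N, measurable_fun setT (Y N)) -> (forall N w, 0 <= Y N w) ->
  0 <= c -> 0 <= r -> r < 1 ->
  (forall N, (0 < N)%N -> (\int[P]_w (Y N w)%:E <= (c * r ^+ N)%:E)%E) ->
  {ae P, forall w, forall eps : R, 0 < eps -> \forall N \near \oo, Y N w < eps}.
Proof.
move=> mY Y0 c0 r0 r1 Yle.
pose Z n w := (Y n.+1 w)%:E.
have mZ n : measurable_fun setT (Z n) by apply/measurable_EFinP.
have Z0 n w : (0 <= Z n w)%E by rewrite lee_fin.
have sumZ : (\int[P]_w (\sum_(n <oo) Z n w) < +oo)%E.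
  rewrite integral_nneseries//.
  apply: (@le_lt_trans _ _ (c * r * (1 - r)^-1)%:E); last exact: ltry.
  apply: lime_le.
    by apply: is_cvg_nneseries => n _ _; exact: integral_ge0.
  apply: nearW => n.
  apply: (@le_trans _ _ (\sum_(0 <= i < n) (c * r ^+ i.+1)%:E)%E).
    by apply: lee_sum => i _; exact: Yle.
  rewrite sumEFin lee_fin big_mkord.
  under eq_bigr do rewrite exprS mulrA.
  rewrite -mulr_sumr; apply: ler_wpM2l; first exact: mulr_ge0.
  exact: geometric_partial_le.
have mS : measurable_fun setT (fun w => \sum_(n <oo) Z n w)%E.
  exact: ge0_emeasurable_sum.
have : P.-integrable setT (fun w => \sum_(n <oo) Z n w)%E.
  apply/integrableP; split => //.
  rewrite (eq_integral (fun w => \sum_(n <oo) Z n w)%E)// => w _.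
  by rewrite gee0_abs// nneseries_ge0.
move=> /integrable_ae => /(_ measurableT).
apply: filterS => w /(_ Logic.I) Sfin eps eps0.
have ub n : \sum_(i < n) Y i.+1 w <= fine (\sum_(i <oo) Z i w)%E.
  rewrite -lee_fin fineK// -sumEFin -(big_mkord predT (fun i => Z i w)).
  exact: nneseries_lim_ge.
have cv : cvgn (series (fun i => Y i.+1 w)).
  apply: nondecreasing_is_cvgn.
    by apply: nondecreasing_series => i _ _; exact: Y0.
  exists (fine (\sum_(i <oo) Z i w)%E) => _ [n _ <-].
  by rewrite /series /= big_mkord.
have /cvgrPdist_lt/(_ eps eps0) [n _ hn] := cvg_series_cvg_0 cv.
exists n.+1 => // -[//|m] /= nm.
by have := hn m nm; rewrite /= sub0r normrN ger0_norm.
Qed.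

End almost_sure.

Section random_bounds.
Context {R : realType} {d : measure_display} {Omega : measurableType d}.
Variables (P : probability Omega R) (q : nat).
Notation p := q.+2.
Variable g : incr_tuple p -> {RV P >-> R}.
Hypothesis hind : mutually_independent g.
Hypothesis hgauss : forall t, standard_gaussian (g t).

Let C : R := (p`!)%:R.
(* With [mu = 1 / C] and [a = 1 / (4 C)], a term of the lattice sum has
   exponent [(mu^2 C / 2 - mu + a) |k|^2 = - a |k|^2] after integration. *)
Let a : R := (4 * C)^-1.

Let C0 : 0 < C. Proof. by rewrite ltr0n fact_gt0. Qed.
Let a0 : 0 < a. Proof. by rewrite invr_gt0 mulr_gt0. Qed.

Let tail (K : nat) : R := 2 * expR (- (a * K%:R)) / (1 - expR (- a)).

(** The vector obtained by leaving the first slot open. *)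
Definition contraction N (Y : 'I_p -> 'I_N -> R) (w : Omega) (i : 'I_N) : R :=
  mform (@sk _ _ _ P q g w N) (set_slot ord0 (basis i) Y).

Let R_ N (K : nat) delta (Y : 'I_p -> 'I_N -> R) w : R :=
  lattice_fun K delta C^-1 a (contraction Y w).

Let lattice_termE N (K : nat) delta (Y : 'I_p -> 'I_N -> R) w :
  R_ K delta Y w = \sum_(k : {ffun 'I_N -> option ('I_(cap N delta).+1 * bool)})
    expR (C^-1 * mform (@sk _ _ _ P q g w N)
                   (set_slot ord0 (fun i => site_val K (k i)) Y)) *
    expR ((a - C^-1) * (\sum_i site_val K (k i) ^+ 2) - a * (delta * N%:R / 4)).
Proof.
apply: eq_bigr => k _; rewrite -expRD; congr expR.
by rewrite mform_slot_sum; ring.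
Qed.

Let measurable_R N K delta (Y : 'I_p -> 'I_N -> R) :
  measurable_fun setT (R_ K delta Y).
Proof.
rewrite (funext (lattice_termE K delta Y)).
apply: measurable_sum => k; apply: measurable_funM => //.
by apply: measurableT_comp => //; apply: measurable_funM => //; exact: measurable_mform.
Qed.

Let integral_R N K delta (Y : 'I_p -> 'I_N -> R) : (0 < N)%N -> (0 < K)%N ->
  0 <= delta -> (forall j, \sum_i Y j i ^+ 2 <= N%:R) ->
  (\int[P]_w (R_ K delta Y w)%:E <=
   (expR ((tail K - a * delta / 4) * N%:R))%:E)%E.
Proof.
move=> N0 K0 delta0 YN.
have prodY (u : 'I_N -> R) :
    \prod_(j < p | j != ord0) \sum_i set_slot ord0 u Y j i ^+ 2 <= N%:R ^+ q.+1.
  apply: (@le_trans _ _ (\prod_(j < p | j != ord0) N%:R)).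
    apply: ler_prod => j j0; rewrite /set_slot (negbTE j0) YN andbT.
    by apply: sumr_ge0 => i _; exact: sqr_ge0.
  by rewrite prodr_const cardC1 card_ord.
under eq_integral do rewrite lattice_termE -sumEFin.
rewrite ge0_integral_sum//; last first.
  move=> k; apply/measurable_EFinP; apply: measurable_funM => //.
  by apply: measurableT_comp => //; apply: measurable_funM => //; exact: measurable_mform.
apply: (@le_trans _ _ (\sum_(k : {ffun 'I_N -> option ('I_(cap N delta).+1 * bool)})
   (expR (- (a * \sum_i site_val K (k i) ^+ 2)) * expR (- (a * (delta * N%:R / 4))))%:E)%E).
  apply: lee_sum => k _; under eq_integral do rewrite EFinM muleC.
  rewrite ge0_integralZl//; last first.
    by apply/measurable_EFinP; apply: measurableT_comp => //; apply: measurable_funM => //; exact: measurable_mform.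
  have := mform_mgf hind hgauss C^-1 N0 (prodY (fun i => site_val K (k i))).
  move=> h; apply: le_trans (lee_wpmul2l _ h) _; first by rewrite lee_fin expR_ge0.
  rewrite -EFinM lee_fin -!expRD ler_expR /set_slot eqxx -/C.
  rewrite le_eqVlt; apply/orP; left; apply/eqP.
  by rewrite /a; field; rewrite gt_eqF.
rewrite sumEFin lee_fin -mulr_suml mulrBl expRD.
rewrite (_ : a * delta / 4 * N%:R = a * (delta * N%:R / 4)); last by ring.
by apply: ler_wpM2r; [exact: expR_ge0|exact: sum_lattice_gaussian].
Qed.

Let R_ge0 N K delta (Y : 'I_p -> 'I_N -> R) w : 0 <= R_ K delta Y w.
Proof. exact: lattice_fun_ge0. Qed.

(** A union bound over at most [D^N] choices of the slots is affordable because
    the rate [a delta / 4] of the lattice bound can be made as large as needed. *)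
Lemma contraction_sup_bound (F : nat -> finType) (D : nat)
    (Y : forall N, F N -> 'I_p -> 'I_N -> R) :
  (forall N, (0 < N)%N -> (#|F N| <= D ^ N)%N) ->
  (forall N f j, \sum_i Y N f j i ^+ 2 <= N%:R) ->
  exists2 A : R, 0 < A & {ae P, forall w, \forall N \near \oo,
    forall f : F N, \sum_i contraction (Y N f) w i ^+ 2 <= A * N%:R}.
Proof.
move=> FD YN.
have d0 : 0 < 1 - expR (- a) by rewrite subr_gt0 expR_lt1 oppr_lt0.
have t0 : 0 <= tail 1 by rewrite /tail divr_ge0 ?mulr_ge0 ?expR_ge0// ltW.
pose delta := 4 * (tail 1 + D%:R + 1) / a.
have delta0 : 0 <= delta by rewrite divr_ge0 ?mulr_ge0 ?addr_ge0// ltW.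
exists (1 + delta); first by rewrite ltr_wpDr.
pose Z N w := \sum_(f : F N) R_ 1 delta (Y N f) w.
have mZ N : measurable_fun setT (Z N).
  by apply: measurable_sum => f; exact: measurable_R.
have Z0 N w : 0 <= Z N w by apply: sumr_ge0.
have Zle N : (0 < N)%N -> (\int[P]_w (Z N w)%:E <= (1 * expR (-1) ^+ N)%:E)%E.
  move=> N0; rewrite /Z; under eq_integral do rewrite -sumEFin.
  rewrite ge0_integral_sum//; last 2 first.
  - by move=> f; apply/measurable_EFinP.
  - by move=> f w _; rewrite lee_fin.
  apply: (@le_trans _ _ (\sum_(f : F N) (expR ((tail 1 - a * delta / 4) * N%:R))%:E)%E).
    by apply: lee_sum => f _; apply: integral_R => // j.
  rewrite sumEFin lee_fin sumr_const -(mulr_natl (expR _)).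
  apply: (@le_trans _ _ (expR (D%:R * N%:R) * expR ((tail 1 - a * delta / 4) * N%:R))).
    apply: ler_wpM2r; first exact: expR_ge0.
    apply: (@le_trans _ _ (D ^ N)%:R); first by rewrite ler_nat FD.
    rewrite natrX mulrC expRM_natl lerXn2r ?nnegrE ?expR_ge0//.
    by apply: le_trans (expR_ge1Dx _); rewrite lerDr.
  rewrite -expRD mul1r -expRM_natl ler_expR le_eqVlt; apply/orP; left; apply/eqP.
  by rewrite /delta; field; rewrite gt_eqF.
have e1 : expR (-1) < 1 :> R by rewrite expR_lt1 oppr_lt0.
have := ae_cvg0_of_summable mZ Z0 ler01 (expR_ge0 _) e1 Zle.
apply: filterS => w /(_ 1 ltr01); apply: filterS => N ZN f.
have small : \sum_(i | 1%:R <= `|contraction (Y N f) w i|) contraction (Y N f) w i ^+ 2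
             <= delta * N%:R.
  rewrite leNgt; apply/negP => big.
  have Ci : 0 <= C^-1 by rewrite invr_ge0 ltW.
  have := lattice_fun_ge1 (ltn0Sn 0) Ci (ltW a0) big.
  rewrite leNgt => /negP; apply; apply: le_lt_trans ZN.
  rewrite /Z (bigD1 f)//= lerDl; exact: sumr_ge0.
rewrite mulrDl mul1r; apply: le_trans (_ : _ <= N%:R + _) _; last by rewrite lerD2l; exact: small.
rewrite -[X in X%:R + _]card_ord -sumr_const [X in _ <= _ + X]big_mkcond -big_split/=.
apply: ler_sum => i _; case: ifPn; first by rewrite lerDr.
rewrite -ltNge => lt1; rewrite addr0 -real_normK ?num_real//.
by rewrite expr_le1// ltW.
Qed.

(** Here [delta] may be small: the loss [tail K] from the number of integer vectors
    tends to zero with [K], and averaging over configurations instead of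
    maximizing costs no entropy. *)
Lemma contraction_tail_fraction (Y : forall N, {ffun 'I_N -> bool} -> 'I_p -> 'I_N -> R)
    (delta theta : R) : 0 < delta -> 0 < theta ->
  (forall N x j, \sum_i Y N x j i ^+ 2 <= N%:R) ->
  exists2 K : R, 0 < K & {ae P, forall w, \forall N \near \oo,
    \sum_(x : {ffun 'I_N -> bool} |
       delta * N%:R < \sum_(i | K <= `|contraction (Y N x) w i|) contraction (Y N x) w i ^+ 2) 1
    <= theta * 2 ^+ N}.
Proof.
move=> delta0 theta0 YN.
have d0 : 0 < 1 - expR (- a) by rewrite subr_gt0 expR_lt1 oppr_lt0.
pose K := (Num.truncn (16 / (a ^+ 2 * delta * (1 - expR (- a))))).+1.
have K0 : (0 < K)%N by [].
have Kr0 : 0 < K%:R :> R by rewrite ltr0n.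
have tK : tail K <= a * delta / 8.
  have hK : 16 / (a ^+ 2 * delta * (1 - expR (- a))) < K%:R by exact: truncnS_gt.
  rewrite /tail ler_pdivrMr//.
  apply: (@le_trans _ _ (2 * (a * K%:R)^-1)).
    apply: ler_wpM2l => //; rewrite expRN lef_pV2 ?posrE ?expR_gt0 ?mulr_gt0//.
    by apply: le_trans (expR_ge1Dx _); rewrite lerDr.
  rewrite ler_pdivrMr ?mulr_gt0//.
  move: hK; rewrite ltr_pdivrMr; last by rewrite !mulr_gt0 ?exprn_gt0.
  by move=> /ltW h; move: h; rewrite expr2; lra.
exists K%:R => //.
pose Z N w := (2 ^+ N)^-1 * \sum_(x : {ffun 'I_N -> bool}) R_ K delta (Y N x) w.
have mZ N : measurable_fun setT (Z N).
  by apply: measurable_funM => //; apply: measurable_sum => x; exact: measurable_R.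
have P0 N : 0 < 2 ^+ N :> R by rewrite exprn_gt0.
have Z0 N w : 0 <= Z N w.
  by apply: mulr_ge0; [rewrite invr_ge0 ltW|exact: sumr_ge0].
have Zle N : (0 < N)%N ->
    (\int[P]_w (Z N w)%:E <= (1 * expR (- (a * delta / 8)) ^+ N)%:E)%E.
  move=> N0; rewrite /Z; under eq_integral do rewrite EFinM -sumEFin.
  rewrite ge0_integralZl//; last 2 first.
  - by apply: emeasurable_sum => x; exact/measurable_EFinP.
  - by move=> w _; apply: sume_ge0 => x _; rewrite lee_fin.
  rewrite ge0_integral_sum//; last 2 first.
  - by move=> f; apply/measurable_EFinP.
  - by move=> f w _; rewrite lee_fin.
  apply: (@le_trans _ _ (((2 ^+ N)^-1)%:E *
     \sum_(x : {ffun 'I_N -> bool}) (expR (- (a * delta / 8)) ^+ N)%:E)%E).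
    apply: lee_wpmul2l; first by rewrite lee_fin invr_ge0 ltW.
    apply: lee_sum => x _; apply: le_trans (integral_R N0 K0 (ltW delta0) (YN N x)) _.
    rewrite lee_fin -expRM_natl ler_expR mulrC; apply: ler_wpM2l => //.
    by move: tK; lra.
  by rewrite sumEFin -EFinM lee_fin sum_cube_cst mulKf ?gt_eqF// mul1r.
have e1 : expR (- (a * delta / 8)) < 1 by rewrite expR_lt1 oppr_lt0 divr_gt0 ?mulr_gt0.
have := ae_cvg0_of_summable mZ Z0 ler01 (expR_ge0 _) e1 Zle.
apply: filterS => w /(_ theta theta0); apply: filterS => N.
rewrite /Z ltr_pdivrMl// => ZN; rewrite [leRHS]mulrC.
apply: le_trans (_ : _ <= _) (ltW ZN); rewrite big_mkcond; apply: ler_sum => x _.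
case: ifP => [big|_]; last exact: R_ge0.
have Ci : 0 <= C^-1 by rewrite invr_ge0 ltW.
exact: (lattice_fun_ge1 K0 Ci (ltW a0) big).
Qed.

(** Exponential Markov inequality, with
    [E e^(1/10 - g^2) = e^(1/10) / sqrt 3 <= 5 / 6]. *)
Lemma sum_sqr_gaussian_lb (S : nat -> seq (incr_tuple p)) :
  (forall N, uniq (S N)) -> (forall N, N %/ p <= size (S N))%N ->
  {ae P, forall w, \forall N \near \oo,
    (size (S N))%:R / 10 <= \sum_(s <- S N) (g s w) ^+ 2}.
Proof.
move=> uS szS.
pose Z N w := expR ((size (S N))%:R / 10 - \sum_(s <- S N) (g s w) ^+ 2).
have mg s : measurable_fun setT (g s) by exact: measurable_funP.
have mZ N : measurable_fun setT (Z N).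
  apply: measurableT_comp => //; apply: measurable_funB => //.
  by apply: measurable_sum => s; exact: measurable_funX.
have Z0 N w : 0 <= Z N w by exact: expR_ge0.
pose b : R := - ln (5 / 6).
have b0 : 0 < b by rewrite oppr_gt0 ln_lt0//; lra.
have bE : expR (- b) = 5 / 6 by rewrite opprK lnK// posrE; lra.
have Zle N : (0 < N)%N ->
    (\int[P]_w (Z N w)%:E <= (expR b * expR (- (b / p%:R)) ^+ N)%:E)%E.
  move=> N0.
  have E w : Z N w = expR ((size (S N))%:R / 10) * \prod_(s <- S N) expR (- (g s w) ^+ 2).
    by rewrite /Z expRD -sumrN expR_sum.
  under eq_integral do rewrite E EFinM.
  have mf (s : incr_tuple p) : measurable_fun [set: R] (fun x : R => expR (- x ^+ 2)).
    by apply: measurableT_comp => //; apply: measurableT_comp => //.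
  rewrite ge0_integralZl//; last 2 first.
  - apply/measurable_EFinP.
    apply: (@measurable_prod _ _ _ _ _ (S N) (fun s w => expR (- (g s w) ^+ 2))) => s _.
    exact: (measurableT_comp (mf s) (mg s)).
  - by move=> w _; rewrite lee_fin; apply: prodr_ge0 => s _; exact: expR_ge0.
  rewrite (integral_prod_indep hind (f := fun s x => expR (- x ^+ 2)))//; last first.
    by move=> s; rewrite gaussian_expN_sq.
  under eq_bigr do rewrite gaussian_expN_sq//.
  rewrite prodEFin -EFinM lee_fin big_const_seq count_predT iter_mulr_1.
  rewrite mulrC expRM_natl -exprMn.
  have h56 : expR (10^-1) * (Num.sqrt 3)^-1 <= expR (- b) :> R.
    have h1 : expR (10^-1) <= (9 / 10)^-1 :> R.
      have n1 : 0 < 9 / 10 :> R by lra.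
      rewrite -[leLHS]invrK -expRN lef_pV2 ?posrE ?expR_gt0 ?n1//.
      by apply: le_trans (expR_ge1Dx _); lra.
    have h2 : (Num.sqrt 3)^-1 <= (4 / 3)^-1 :> R.
      have n2 : 0 < 4 / 3 :> R by lra.
      rewrite lef_pV2 ?posrE ?sqrtr_gt0 ?n2//.
      rewrite (_ : 4 / 3 = Num.sqrt ((4 / 3) ^+ 2)); last first.
        by rewrite sqrtr_sqr ger0_norm//; lra.
      by rewrite ler_sqrt// expr2; lra.
    rewrite bE (_ : 5 / 6 = (9 / 10)^-1 * (4 / 3)^-1); last by field.
    by apply: ler_pM; rewrite ?expR_ge0 ?invr_ge0 ?sqrtr_ge0.
  apply: (@le_trans _ _ (expR (- b) ^+ (size (S N)))).
    rewrite mulrC in h56.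
    by apply: lerXn2r; rewrite ?nnegrE ?mulr_ge0 ?expR_ge0 ?invr_ge0 ?sqrtr_ge0.
  rewrite -!expRM_natl -expRD ler_expR.
  have hN : N%:R <= p%:R * ((size (S N))%:R + 1) :> R.
    rewrite natr1 -natrM ler_nat.
    apply: (@leq_trans (p * (N %/ p).+1)%N); last by rewrite leq_mul2l ltnS szS orbT.
    by rewrite mulnC ltnW// ltn_ceil.
  have : b / p%:R * N%:R <= b * ((size (S N))%:R + 1).
    rewrite -mulrA; apply: ler_wpM2l; first exact: ltW.
    by rewrite ler_pdivrMl ?ltr0n.
  by move: (b / p%:R) ((size (S N))%:R : R) => r n; lra.
have e1 : expR (- (b / p%:R)) < 1.
  by rewrite expR_lt1 oppr_lt0 divr_gt0 ?ltr0n.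
have := ae_cvg0_of_summable mZ Z0 (expR_ge0 _) (expR_ge0 _) e1 Zle.
apply: filterS => w /(_ 1 ltr01); apply: filterS => N.
by rewrite /Z expR_lt1 subr_lt0 => /ltW.
Qed.

End random_bounds.

(** * The Sherrington-Kirkpatrick tensors *)

Section block_tuples.
Context {p N : nat}.
Notation n := (N %/ p)%N.

Let block_lt (f : {ffun 'I_p -> 'I_n}) (l : 'I_p) : (l * n + f l < N)%N.
Proof.
apply: (@leq_trans (l.+1 * n)); first by rewrite mulSn addnC ltn_add2r.
by apply: leq_trans (leq_trunc_div N p); rewrite mulnC leq_mul2l ltn_ord orbT.
Qed.

(** One index in each of [p] consecutive blocks of length [N / p]: such tuples are
    increasing, there are [(N / p)^p] of them, and exactly their first index lies
    in the first block. *)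
Definition block_tuple (f : {ffun 'I_p -> 'I_n}) : p.-tuple 'I_N :=
  [tuple Ordinal (block_lt f l) | l < p].

Lemma block_tuple_incr f : sorted ltn (map_tuple val (block_tuple f)).
Proof.
apply/(sortedP 0) => k; rewrite size_tuple => kp.
have nthE (l : 'I_p) : nth 0 (map_tuple val (block_tuple f)) l = (l * n + f l)%N.
  by rewrite -tnth_nth tnth_map tnth_mktuple.
rewrite (nthE (Ordinal kp)) (nthE (Ordinal (ltnW kp))) /=.
apply: (@leq_trans (k.+1 * n)); last exact: leq_addr.
by rewrite mulSn addnC ltn_add2r.
Qed.

Definition block_incr f : incr_tuple p :=
  exist (fun t : p.-tuple nat => sorted ltn t) _ (block_tuple_incr f).

Lemma block_tuple_inj : injective block_tuple.
Proof.
move=> f f' ff'; apply/ffunP => l; apply: val_inj => /=.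
have := congr1 (fun t : p.-tuple 'I_N => val (tnth t l)) ff'.
by rewrite !tnth_mktuple /= => /addnI.
Qed.

Lemma block_incr_inj : injective block_incr.
Proof.
move=> f f' ff'; apply: block_tuple_inj; apply: val_inj.
apply: (inj_map val_inj).
exact: (congr1 (fun s : incr_tuple p => val (val s)) ff').
Qed.

Lemma sk_tensor_block {R : realType} (g : incr_tuple p -> R) f :
  sk_tensor g (block_tuple f) = N%:R `^ ((1 - p%:R) / 2) * g (block_incr f).
Proof.
by rewrite sk_tensorE (sk_key_incr (s := block_incr f)).
Qed.

End block_tuples.

Section first_block.
Context {q N : nat}.
Notation p := q.+2.
Notation n := (N %/ p)%N.

Definition first_block : pred 'I_N := fun i => (i < n)%N.

Lemma block_tuple_first (f : {ffun 'I_p -> 'I_n}) :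
  first_block (thead (block_tuple f)) &&
  all (predC first_block) (behead (block_tuple f)).
Proof.
apply/andP; split; first by rewrite /thead tnth_mktuple /first_block /= mul0n add0n.
apply/allP => i /tnthP /= [k].
have -> : tnth (behead_tuple (block_tuple f)) k = tnth (block_tuple f) (lift ord0 k).
  by rewrite [in RHS](tuple_eta (block_tuple f)) tnthS.
rewrite tnth_mktuple => ->; rewrite /first_block /= -leqNgt /bump /=.
by rewrite mulSn -addnA leq_addr.
Qed.

Lemma sum_sqr_block_le {R : realType} (J : p.-tuple 'I_N -> R) :
  \sum_(f : {ffun 'I_p -> 'I_n}) J (block_tuple f) ^+ 2 <=
  \sum_(t | first_block (thead t) && all (predC first_block) (behead t)) J t ^+ 2.
Proof.
rewrite -(big_imset (fun t => J t ^+ 2) (h := @block_tuple p N) (A := predT))/=; last first.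
  by move=> f f' _ _; exact: block_tuple_inj.
rewrite big_mkcond [leRHS]big_mkcond; apply: ler_sum => t _.
case: ifP => [/imsetP[f _ ->]|_]; first by rewrite block_tuple_first.
by case: ifP => _ //; exact: sqr_ge0.
Qed.

(** For [N >= p] one has [N <= 2 p (N / p)] with the Euclidean quotient. *)
Lemma block_count {R : realType} : (p <= N)%N ->
  (10 * (2 * p%:R) ^+ p)^-1 * N%:R <=
  (N%:R `^ ((1 - p%:R) / 2)) ^+ 2 * ((n ^ p)%N%:R / 10) :> R.
Proof.
move=> pN; have N0 : (0 < N)%N by exact: leq_trans pN.
have h : N%:R ^+ p <= (2 * p%:R) ^+ p * (n ^ p)%N%:R :> R.
  rewrite natrX -exprMn lerXn2r ?nnegrE// ?mulr_ge0// -!natrM ler_nat.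
  have n0 : (0 < n)%N by rewrite divn_gt0.
  apply: (@leq_trans (n.+1 * p)%N); first by rewrite ltnW// ltn_ceil.
  by move: n0; move: (N %/ p)%N p => m r m0; nia.
have b2 := sk_scale_sqr (R := R) q N0.
set b := (_ `^ _) ^+ 2 in b2 *.
have b0 : 0 <= b by exact: sqr_ge0.
have p20 : 0 < (2 * p%:R) ^+ p :> R by rewrite exprn_gt0// mulr_gt0// ltr0n.
have := ler_wpM2l b0 h.
rewrite exprS mulrCA b2 mulr1 => h2.
rewrite mulrC ler_pdivrMr; last by apply: mulr_gt0.
by move: h2; move: ((2 * p%:R) ^+ p) b {b0 b2 p20} => T b h2; lra.
Qed.

End first_block.

Section ternary_forms.
Context {R : realType} {d : measure_display} {Omega : measurableType d}.
Variables (P : probability Omega R) (q : nat).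
Notation p := q.+2.
Variable g : incr_tuple p -> {RV P >-> R}.
Hypothesis hind : mutually_independent g.
Hypothesis hgauss : forall t, standard_gaussian (g t).

Lemma ternary_sqr_sum N (u : 'I_N -> R) : ternary u ->
  \sum_i u i ^+ 2 <= N%:R.
Proof.
move=> tu; rewrite -[X in X%:R]card_ord -sumr_const; apply: ler_sum => i _.
by case: (tu i) => [->|[->|->]]; rewrite ?expr0n ?sqrrN ?expr1n.
Qed.

Lemma spin_ternary N (x : {ffun 'I_N -> bool}) : ternary (@spin R N x).
Proof. by move=> i; rewrite /spin; case: (x i); right; [left|right]. Qed.

Lemma outer_ternary N (B : pred 'I_N) x : ternary (@outer R N B x).
Proof.
move=> i; rewrite /outer; case: (B i); first by left.
exact: spin_ternary.
Qed.

(** The ternary values are encoded by subtracting 1 from an ordinal below 3, which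
    leaves [3^(p N)] choices of slots. *)
Lemma ternary_contraction_bound : exists2 A : R, 0 < A &
  {ae P, forall w, \forall N \near \oo, forall u : 'I_p -> 'I_N -> R,
    (forall j, ternary (u j)) ->
    \sum_i mform (@sk _ _ _ P q g w N) (set_slot ord0 (basis i) u) ^+ 2
      <= A * N%:R}.
Proof.
pose F N : finType := {ffun 'I_p -> {ffun 'I_N -> 'I_3}}.
pose Y N (f : F N) (j : 'I_p) (i : 'I_N) : R := (f j i)%:R - 1.
have [] := contraction_sup_bound hind hgauss (D := (3 ^ p)%N) (Y := Y).
- by move=> N _; rewrite /F !card_ffun !card_ord expnAC.
- move=> N f j; apply: ternary_sqr_sum => i; rewrite /Y.
  case: (f j i) => -[|[|[|//]]] /= _; rewrite ?sub0r ?subrr ?addrK; [by right; right|by left|].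
  by right; left; ring.
move=> A A0 h; exists A => //; apply: filterS h => w; apply: filterS => N h u tu.
have exo j i : exists o : 'I_3, (o : nat)%:R - 1 = u j i.
  case: (tu j i) => [->|[->|->]].
  - by exists (@Ordinal 3 1 isT); rewrite subrr.
  - by exists (@Ordinal 3 2 isT) => /=; ring.
  - by exists (@Ordinal 3 0 isT); rewrite sub0r.
pose f : F N := [ffun j => [ffun i => projT1 (cid (exo j i))]].
have -> : u = Y N f.
  apply/funext => j; apply/funext => i; rewrite /Y !ffunE.
  by case: (cid _).
exact: h.
Qed.

(** Row [i] is the contraction with [e_i] in the second slot; scaled by [sqrt N],
    this vector has the same length as a sign vector. *)
Lemma row_bound : exists2 A : R, 0 < A &
  {ae P, forall w, \forall N \near \oo, forall (x : {ffun 'I_N -> bool}) i,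
    \sum_j bform (@sk _ _ _ P q g w N) (basis j) (basis i) x ^+ 2 <= A}.
Proof.
pose F N : finType := ({ffun 'I_N -> bool} * 'I_N)%type.
pose o1 : 'I_p := lift ord0 ord0.
pose Y N (f : F N) : 'I_p -> 'I_N -> R :=
  set_slot o1 (fun k => Num.sqrt N%:R * basis f.2 k) (fun=> spin f.1).
have [] := contraction_sup_bound hind hgauss (D := 4) (Y := Y).
- move=> N _; rewrite /F card_prod card_ffun card_bool !card_ord.
  by rewrite (expnMn 2 2) leq_mul2l ltnW ?orbT// ltn_expl.
- move=> N f j; rewrite /Y /set_slot; case: eqP => _; last first.
    exact/ternary_sqr_sum/spin_ternary.
  rewrite (bigD1 f.2)//= big1 ?addr0 => [|k /negbTE kf].
    by rewrite /basis eqxx mulr1 sqr_sqrtr.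
  by rewrite /basis kf mulr0 expr0n.
move=> A A0 h; exists A => //; apply: filterS h => w h.
near=> N => x i.
have N0 : (0 < N)%N by near: N; exact: nbhs_infty_gt.
have hN : forall f : F N, \sum_i contraction g (Y N f) w i ^+ 2 <= A * N%:R by near: N.
have := hN (x, i); rewrite -ler_pdivrMr ?ltr0n//; apply: le_trans.
rewrite ler_pdivlMr ?ltr0n// mulr_suml; apply: ler_sum => j _.
have symJ := @sk_tensor_sym R p N (fun t => g t w).
have -> : contraction g (Y N (x, i)) w j =
    Num.sqrt N%:R * bform (@sk _ _ _ P q g w N) (basis j) (basis i) x.
  rewrite (bformC symJ) -mform_slotZ -[RHS]/(bform _ _ _ _).
  by rewrite (bformC symJ).
by rewrite exprMn sqr_sqrtr// mulrC.
Unshelve. all: by end_near.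
Qed.

End ternary_forms.

Theorem corollary2p5 (R : realType) (p : nat) (hp : (2 <= p)%N)
  (d : measure_display) (Omega : measurableType d) (P : probability Omega R)
  (g : incr_tuple p -> {RV P >-> R})
  (hind : mutually_independent g)
  (hgauss : forall t : incr_tuple p, standard_gaussian (g t)) :
  {ae P, forall omega : Omega, forall beta : R, 0 < beta ->
    mpl_sqrt_consistent (sk_tensor (fun t => g t omega)) beta}.
Proof.
case: p hp g hind hgauss => [//|[//|q]] _ g hind hgauss.
pose c1 : R := (10 * (2 * q.+2%:R) ^+ q.+2)^-1.
have p20 : 0 < (2 * q.+2%:R) ^+ q.+2 :> R by rewrite exprn_gt0// mulr_gt0// ltr0n.
have c10 : 0 < c1 by rewrite invr_gt0; apply: mulr_gt0.
have [A1 A10 ae1] := ternary_contraction_bound hind hgauss.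
have [A2 A20 ae2] := row_bound hind hgauss.
(* With these values half of the second moment [c1] survives in
   [sum_abs_cavity_lb]. *)
pose delta := c1 / 4; pose theta := c1 / (4 * A1).
have delta0 : 0 < delta by rewrite divr_gt0.
have theta0 : 0 < theta by rewrite divr_gt0// mulr_gt0.
pose B N := @first_block q N.
have [K K0 ae3] := contraction_tail_fraction hind hgauss
  (Y := fun N x (_ : 'I_q.+2) => outer (B N) x) delta0 theta0
  (fun N x j => ternary_sqr_sum (outer_ternary (B N) x)).
pose S N := [seq block_incr f |
             f <- enum {ffun 'I_q.+2 -> 'I_(N %/ q.+2)}].
have szS N : size (S N) = ((N %/ q.+2) ^ q.+2)%N.
  by rewrite size_map -cardE card_ffun !card_ord.
have ae4 : {ae P, forall w, \forall N \near \oo,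
    (size (S N))%:R / 10 <= \sum_(s <- S N) (g s w) ^+ 2}.
  apply: (sum_sqr_gaussian_lb hind hgauss) => N.
    by rewrite map_inj_uniq ?enum_uniq//; exact: block_incr_inj.
  rewrite szS; case: (N %/ q.+2)%N => // m.
  by rewrite -{1}(expn1 m.+1) leq_pexp2l.
apply: (filterS2 _ _ (filterI ae1 ae2) (filterI ae3 ae4)) => w [ev1 ev2] [ev3 ev4] beta beta0.
pose J N := @sk _ _ _ P q g w N.
have symJ N := @sk_tensor_sym R q.+2 N (fun t => g t w).
have diagJ N := @sk_tensor_diag R q.+2 N (fun t => g t w).
pose A := A1 + A2.
pose C := (1 + A1) / 2.
have C0 : 0 < C by rewrite divr_gt0// addr_gt0.
pose c := (c1 - delta - theta * A1) / K.
have cE : c = c1 / 2 / K.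
  by rewrite /c /theta /delta; congr (_ / _); field; rewrite gt_eqF.
have c0 : 0 < c by rewrite cE !divr_gt0.
pose u := beta * (q.+2%:R * c).
have u0 : 0 < u by apply: mulr_gt0 => //; apply: mulr_gt0 => //; rewrite ltr0n.
pose v := beta * (2 ^+ q.+2 * C) + 1.
have v0 : 0 < v.
  by apply: addr_gt0 => //; apply: mulr_gt0 => //; apply: mulr_gt0 => //; rewrite exprn_gt0.
pose s := Num.min 1 (u / (2 * v)).
have s0 : 0 < s by rewrite lt_min ltr01 divr_gt0// mulr_gt0.
have s1 : s <= 1 by rewrite ge_min lexx.
have sv : s * v <= u / 2.
  rewrite -ler_pdivlMr// (_ : u / 2 / v = u / (2 * v)).
    by rewrite ge_min lexx orbT.
  by field; rewrite gt_eqF.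
pose kappa := beta * (s * (q.+2%:R * c) - 2 ^+ q.+2 * (s ^+ 2 * C)) - s ^+ 2.
have kappa0 : 0 < kappa.
  (* The gain [u s] is linear and the cost [v s^2] quadratic; the choice
     [s <= u / (2 v)] keeps half of the gain. *)
  have -> : kappa = s * (u - s * v) by rewrite /kappa /u /v; ring.
  by apply: mulr_gt0 => //; lra.
have A0 : 0 < A by exact: addr_gt0.
apply: (@mpl_consistency R q J symJ diagJ beta A kappa) => //.
near=> N.
have N0 : (0 < N)%N by near: N; exact: nbhs_infty_gt.
have pN : (q.+2 <= N)%N by near: N; exact: nbhs_infty_ge.
have tern : forall u : 'I_q.+2 -> 'I_N -> R, (forall j, ternary (u j)) ->
    \sum_i mform (J N) (set_slot ord0 (basis i) u) ^+ 2 <= A1 * N%:R by near: N.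
have AN : A1 * N%:R <= A * N%:R by apply: ler_wpM2r => //; rewrite lerDl ltW.
split.
- move=> x y; apply: le_trans AN; apply: tern => j.
  by rewrite /set_slot; case: ifP => _; exact: spin_ternary.
- move=> x i; apply: (@le_trans _ _ A2); last by rewrite lerDr ltW.
  by move: x i; near: N.
have formC (z : 'I_q.+2 -> 'I_N -> R) : (forall j, ternary (z j)) ->
    `|mform (J N) z| <= C * N%:R.
  move=> tz.
  have -> : mform (J N) z = \sum_i z ord0 i * mform (J N) (set_slot ord0 (basis i) z).
    rewrite -mform_slot_sum; apply: eq_mform => j i.
    by rewrite /set_slot; case: eqP => // ->.
  apply: le_trans (ler_norm_sum _ _ _) _.
  apply: (@le_trans _ _ (\sum_i (z ord0 i ^+ 2 +
     mform (J N) (set_slot ord0 (basis i) z) ^+ 2) / 2)).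
    apply: ler_sum => i _; rewrite normrM.
    rewrite -[z ord0 i ^+ 2]real_normK ?num_real//.
    rewrite -[mform _ _ ^+ 2]real_normK ?num_real//.
    move: `|z ord0 i| `|mform _ _| => a b.
    by have := sqr_ge0 (a - b); rewrite !expr2; lra.
  rewrite -mulr_suml big_split/= /C.
  have := tern z tz; have := ternary_sqr_sum (tz ord0).
  by move: (\sum_i _) (\sum_i _) => a b; lra.
apply: (@free_energy_lb R q N (J N) (symJ N) (diagJ N) (B N) beta C c s) => //; try exact: ltW.
apply: (@sum_abs_cavity_lb R q N (J N) (B N) A1 K c1 delta theta K0); last 2 first.
- exact: ltW.
- exact: ltW.
- move=> x; apply: tern => j; exact: outer_ternary.
- apply: le_trans (sum_cavity_sqr_lb (symJ N) (diagJ N) (B N)).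
  rewrite ler_pM2l ?exprn_gt0//.
  apply: le_trans (sum_sqr_block_le _).
  have h4 : (size (S N))%:R / 10 <= \sum_(s <- S N) (g s w) ^+ 2 by near: N.
  apply: le_trans (block_count pN) _.
  rewrite -szS; apply: le_trans (ler_wpM2l (sqr_ge0 _) h4) _.
  rewrite /S big_map big_enum/= mulr_sumr le_eqVlt; apply/orP; left; apply/eqP.
  by apply: eq_bigr => f _; rewrite -exprMn /J /sk sk_tensor_block.
- by near: N.
Unshelve. all: by end_near.
Qed.
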